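(* Let $(X,d,\delta)$ be a dilatation structure and $x\in X$. The following are consequences of the Axioms A0–A3 only: (a) For all $u,v\in X$ such that $d(x,u)\le1$ and $d(x,v)\le1$, and all $\mu$ with $\nu(\mu)\in(0,A)$ (such that $\delta^x_\mu u,\delta^x_\mu v$ are defined and lie in the domain $\bar B_d(x,A)$ of $d^x$), we have $$d^x(u,v)=\frac1{\nu(\mu)}\,d^x(\delta^x_\mu u,\delta^x_\mu v).$$ (b) The curve $\varepsilon>0\mapsto\mathbb P^x(\varepsilon)=[\bar B_{d^x}(x,1),(\delta,\varepsilon),x]$ is a metric profile (after being extended by continuity to $\varepsilon=0$), where $\bar B_{d^x}(x,1)=\{y: d^x(x,y)\le1\}$ and $(\delta,\varepsilon)$ is the distance on it given by $(\delta,\varepsilon)(u,v)=\frac1\varepsilon d(\delta^x_\varepsilon u,\delta^x_\varepsilon v)$.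
   Context: **Parameters.** $\Gamma$ is a Hausdorff topological commutative group, written multiplicatively with neutral element $1$, with a continuous group morphism $\nu:\Gamma\to(0,+\infty)$ (multiplicative group) such that $\inf\nu(\Gamma)=0$; the basic case is $\Gamma=(0,+\infty)$, $\nu=\mathrm{id}$. $\Gamma_1=\nu^{-1}((0,1])$. ''$\varepsilon\to0$'' means $\nu(\varepsilon)\to0$; an element $0$ is adjoined to $\Gamma$ with neighbourhoods generated by $\nu^{-1}((0,a))\cup\{0\}$, $a>0$. When $\varepsilon\in\Gamma$ is used as a real number (as in $\frac1\varepsilon$), $\nu(\varepsilon)$ is meant. $\mathcal O(\varepsilon)$ denotes a positive function tending to $0$ as $\varepsilon\to0$. **Dilatation structure.** $(X,d)$ is a complete, locally compact metric space (small balls are compact); $B_d(x,r)$, $\bar B_d(x,r)$ are open and closed balls. $(X,d,\delta)$ is a dilatation structure if: A0. There are constants $A>1$ and $B$. For $\varepsilon\in\Gamma_1$, $x\in X$, the dilatation $\delta^x_\varepsilon:U(x)\to V_\varepsilon(x)$ is a homeomorphism, $\bar B_d(x,A)\subset U(x)$, and for $\nu(\varepsilon)<1$: $B_d(x,\nu(\varepsilon))\subset\delta^x_\varepsilon B_d(x,A)\subset V_\varepsilon(x)\subset U(x)$. For $\nu(\varepsilon)>1$, $\delta^x_\varepsilon:W_\varepsilon(x)\to B_d(x,B)$ is injective, continuous, with continuous inverse on its image, $W_\varepsilon(x)$ is open, $V_{\varepsilon^{-1}}(x)\subset W_\varepsilon(x)$, and $\delta^x_{\varepsilon^{-1}}\delta^x_\varepsilon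 u=u$ for $\varepsilon\in\Gamma_1$, $u\in U(x)$. Moreover for any compact $K\subset X$ there are $R=R(K)>0$ and $\varepsilon_0=\varepsilon_0(K)\in(0,1)$ such that for all $x\in K$, $u,v\in\bar B_d(x,R)$ and $\nu(\varepsilon)\in(0,\varepsilon_0)$: $\delta^x_\varepsilon v\in W_{\varepsilon^{-1}}(\delta^x_\varepsilon u)$. A1. $\delta^x_1=\mathrm{id}$; $\frac1{\nu(\varepsilon)}d(x,\delta^x_\varepsilon x)\to0$ as $\varepsilon\to0$, uniformly for $x$ in compact sets (strong form: $\delta^x_\varepsilon x=x$); the map $(\varepsilon,x,y)\mapsto\delta^x_\varepsilon y$ is continuous on $\mathrm{dom}\,\delta=\{(\varepsilon,x,y)\in\Gamma\times X\times X: y\in U(x)\text{ if }\nu(\varepsilon)\le1,\ y\in W_\varepsilon(x)\text{ otherwise}\}$ and extends continuously to the closure of $\mathrm{dom}\,\delta$ in $(\Gamma\cup\{0\})\times X\times X$, with $\lim_{\varepsilon\to0}\delta^x_\varepsilon y=x$. A2. For any compact $K$, $x\in K$, $\nu(\varepsilon),\nu(\mu)\in(0,1)$, $u,v\in\bar B_d(x,A)$: $\frac{1}{\nu(\varepsilon\mu)}|d(\delta^x_\varepsilon\delta^x_\mu u,\delta^x_\varepsilon\delta^x_\mu v)-d(\delta^x_{\varepsilon\mu}u,\delta^x_{\varepsilon\mu}v)|\le\mathcal O(\varepsilon\mu)$ (strong form: $\delta^x_\varepsilon\delta^x_\mu u=\delta^x_{\varepsilon\mu}u$). A3. For any $x$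 there is a function $(u,v)\mapsto d^x(u,v)$ on $\bar B_d(x,A)^2$ with $\lim_{\varepsilon\to0}\sup\{|\frac1{\nu(\varepsilon)}d(\delta^x_\varepsilon u,\delta^x_\varepsilon v)-d^x(u,v)|:u,v\in\bar B_d(x,A)\}=0$, uniformly for $x$ in compact sets. In a dilatation structure one requires in addition that each $d^x$ be non-degenerate ($d^x(u,v)=0\Rightarrow u=v$) and A4. With $\Delta^x_\varepsilon(u,v)=\delta_{\varepsilon^{-1}}^{\delta^x_\varepsilon u}\delta^x_\varepsilon v$, the limit $\lim_{\varepsilon\to0}\Delta^x_\varepsilon(u,v)=\Delta^x(u,v)$ exists uniformly with respect to $x,u,v$ in compact sets. **Gromov–Hausdorff distance.** For pointed locally compact metric spaces $(X_i,d_i,x_i)$, $i=1,2$, a number $\mu>0$ is admissible if there is a relation $\rho\subset X_1\times X_2$ with $\mathrm{dom}\,\rho$ $\mu$-dense in $X_1$, $\mathrm{im}\,\rho$ $\mu$-dense in $X_2$, $(x_1,x_2)\in\rho$, and $|d_2(x',y')-d_1(x,y)|\le\mu$ for all $(x,x'),(y,y')\in\rho$. $d_{GH}$ is the infimum of admissible $\mu$. $[X,d,x]$ is the pointed isometry class, and $CMS$ is the set of isometry classes of pointed compact metric spaces with the topology given by $d_{GH}$. **Metric profile.** A metric profile is a curve $\mathbb P:[0,a]\to CMS$, $\mathbb P(b)=[X_b,d_b,x_b]$ (with $X_b$ the closed unit ball around $x_b$), such that: it is continuous at $0$; and for any $b\in[0,a]$ and $\varepsilon\in(0,1]$, $d_{GH}(\mathbb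 P(\varepsilon b),\mathbb P^m_{d_b}(\varepsilon,x_b))=\mathcal O(\varepsilon)$, where the function $\mathcal O$ may depend on $b$ and $\mathbb P^m_{d_b}(\varepsilon,x_b)=[\bar B,\frac1\varepsilon d_b,x_b]$, with $\bar B$ the closed ball of radius $1$ around $x_b$ for the distance $\frac1\varepsilon d_b$.
   Formalization: In (a), a μ with ν(μ)=1 must be 1 or a limit of elements with ν≠1 (otherwise A0–A3 leave δ_μ unconstrained and (a) can fail); in (b), each real ε in (0,1] is represented by a chosen element of Γ with ν=ε (1 for ε=1), and X_b need not be the closed unit ball. *)

(* Defs.v *)
From HB Require Import structures.
From mathcomp Require Import all_boot all_order all_algebra.
From mathcomp Require Import all_classical all_reals all_analysis.

Set Implicit Arguments.
Unset Strict Implicit.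
Unset Printing Implicit Defensive.

Import Order.TTheory GRing.Theory Num.Theory.
Import numFieldNormedType.Exports.

Local Open Scope classical_set_scope.
Local Open Scope ring_scope.

HB.mixin Record isCommTopGroup G & Group G & Topological G := {
  topgroup_mulC : forall g h : G, (g * h = h * g)%g ;
  topgroup_mul_continuous : continuous (fun p : G * G => (p.1 * p.2)%g) ;
  topgroup_inv_continuous : continuous (fun g : G => (g^-1)%g)
}.

#[short(type="commTopGroupType")]
HB.structure Definition CommTopGroup :=
  { G of Group G & Topological G & isCommTopGroup G }.

Section Scales.
Context {R : realType} {G : commTopGroupType}.
Implicit Types nu : G -> R.

Record is_modulus nu : Prop := {
  modulus_gt0 : forall g, 0 < nu g ;
  modulusM : forall g h, nu (g * h)%g = nu g * nu h ;
  modulus_continuous : continuous nu ;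
  modulus_inf : inf (range nu) = 0
}.

(* The filter "e -> 0" on G, i.e. nu e -> 0. *)
Definition to0 nu : set_system G :=
  filter_from [set a : R | 0 < a] (fun a => [set g | nu g < a]).

(* G with an element 0 adjoined: [None] is the new element, and its
   neighbourhoods are generated by nu^-1(0, a) together with 0. *)
Definition with_zero nu : Type := option G.

HB.instance Definition _ nu := Choice.copy (with_zero nu) (option G).

Section WithZeroTopology.
Variable nu : G -> R.

Definition with_zero_open (S : set (with_zero nu)) : Prop :=
  open [set g : G | S (Some g)] /\
  (S None -> exists2 a : R, 0 < a & forall g, nu g < a -> S (Some g)).

Lemma with_zero_openT : with_zero_open setT.
Proof. by split; [exact: openT|move=> _; exists 1]. Qed.

Lemma with_zero_openI : setI_closed with_zero_open.
Proof.
move=> S T [oS S0] [oT T0]; split.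
  rewrite (_ : [set g | _] =
    [set g : G | S (Some g)] `&` [set g : G | T (Some g)]) //; exact: openI.
move=> [/S0[a a0 Sa] /T0[b b0 Tb]]; exists (Num.min a b).
  by rewrite lt_min a0.
by move=> g; rewrite lt_min => /andP[/Sa ? /Tb].
Qed.

Lemma with_zero_open_bigU (I : Type) (f : I -> set (with_zero nu)) :
  (forall i, with_zero_open (f i)) -> with_zero_open (\bigcup_i f i).
Proof.
move=> of_; split.
  rewrite (_ : [set g | _] = \bigcup_i [set g : G | f i (Some g)]) //.
  by apply: bigcup_open => i _; case: (of_ i).
move=> [i _ /(of_ i).2[a a0 fa]]; exists a => // g /fa fg; by exists i.
Qed.

HB.instance Definition _ := @isOpenTopological.Build (with_zero nu)
  with_zero_open with_zero_openT with_zero_openI with_zero_open_bigU.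

End WithZeroTopology.
End Scales.

Section DilatationStructure.
Context {R : realType} {G : commTopGroupType} (nu : G -> R) {X : metricType R}.

(* [closed_ball] of the library is the closure of the open ball, which can be
   smaller. *)
Definition cball (x : X) (r : R) : set X := [set y | mdist x y <= r].

Definition complete_space : Prop :=
  forall F : set_system X, ProperFilter F -> cauchy F -> exists l : X, F --> l.

Definition homeo_on (D E : set X) (f : X -> X) : Prop :=
  [/\ f @` D = E, {within D, continuous f} &
      exists g : X -> X,
        {within E, continuous g} /\ forall u, D u -> g (f u) = u].

(* The dilatations are partial maps, encoded as a total function
   [delta e x y] that is only constrained on the set [dil_dom]. *)
Variables (A B : R) (U : X -> set X) (V W : G -> X -> set X).
Variable delta : G -> X -> X -> X.

Definition dil_dom : set (G * X * X) :=
  [set p | if nu p.1.1 <= 1 then U p.1.2 p.2 else W p.1.1 p.1.2 p.2].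

Definition dil_dom0 : set (with_zero nu * X * X) :=
  [set (Some p.1.1 : with_zero nu, p.1.2, p.2) | p in dil_dom].

Record dilatation_A0 : Prop := {
  A0_gt1 : 1 < A ;
  A0_homeo : forall e x, nu e <= 1 -> homeo_on (U x) (V e x) (delta e x) ;
  A0_cball : forall x, cball x A `<=` U x ;
  A0_small : forall e x, nu e < 1 ->
    [/\ ball x (nu e) `<=` delta e x @` ball x A,
        delta e x @` ball x A `<=` V e x & V e x `<=` U x] ;
  A0_large : forall e x, 1 < nu e ->
    [/\ open (W e x), delta e x @` W e x `<=` ball x B,
        homeo_on (W e x) (delta e x @` W e x) (delta e x) &
        V (e^-1)%g x `<=` W e x] ;
  (* the first conjunct says that the left-hand side of the equation is
     defined *)
  A0_inv : forall e x u, nu e <= 1 -> U x u ->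
    dil_dom ((e^-1)%g, x, delta e x u) /\ delta (e^-1)%g x (delta e x u) = u ;
  A0_difference : forall K : set X, compact K ->
    exists r e0 : R, [/\ 0 < r, 0 < e0 < 1 &
      forall x u v e, K x -> cball x r u -> cball x r v -> nu e < e0 ->
        W (e^-1)%g (delta e x u) (delta e x v)]
}.

Record dilatation_A1 : Prop := {
  A1_id : forall x u, U x u -> delta 1%g x u = u ;
  A1_base : forall K : set X, compact K -> forall eta : R, 0 < eta ->
    \forall e \near to0 nu, forall x, K x ->
      (nu e)^-1 * mdist x (delta e x x) <= eta ;
  A1_continuous :
    {within dil_dom, continuous (fun p : G * X * X => delta p.1.1 p.1.2 p.2)} ;
  A1_extension : exists deltabar : with_zero nu * X * X -> X,
    [/\ {within closure dil_dom0, continuous deltabar},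
        forall e x y, dil_dom (e, x, y) ->
          deltabar (Some e, x, y) = delta e x y &
        forall x y, closure dil_dom0 (None, x, y) ->
          deltabar (None, x, y) = x]
}.

Definition dilatation_A2 : Prop :=
  forall K : set X, compact K ->
  exists O : G -> R, [/\ forall e, 0 < O e, O e @[e --> to0 nu] --> (0 : R) &
    forall x e m u v, K x -> nu e < 1 -> nu m < 1 ->
      cball x A u -> cball x A v ->
      (nu (e * m)%g)^-1 *
        `|mdist (delta e x (delta m x u)) (delta e x (delta m x v))
          - mdist (delta (e * m)%g x u) (delta (e * m)%g x v)|
      <= O (e * m)%g].

(* [dx x u v] is d^x(u, v); only its values for u and v in [cball x A] are
   meaningful. Non-degeneracy of d^x is not required. *)
Definition dilatation_A3 (dx : X -> X -> X -> R) : Prop :=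
  forall K : set X, compact K -> forall eta : R, 0 < eta ->
    \forall e \near to0 nu, forall x u v, K x -> cball x A u -> cball x A v ->
      `|(nu e)^-1 * mdist (delta e x u) (delta e x v) - dx x u v| <= eta.

(* A2 says nothing about dilatations whose coefficient m <> 1 has nu m = 1,
   unless m is a limit of coefficients of modulus <> 1. If m is isolated from
   those (as (-1, 1) in {-1, 1} * 2^Z), then delta m x can be a non-isometric
   involution of U x. Every m with nu m <> 1 satisfies the condition below, and so does
   every m when G = (0, +oo). *)
Definition A2_determined (m : G) : Prop :=
  m = 1%g \/ closure [set g : G | nu g != 1] m.

Definition dx_unit_ball (dx : X -> X -> X -> R) (x : X) : set X :=
  [set y | cball x A y /\ dx x x y <= 1].

Definition dil_dist (e : G) (x u v : X) : R :=
  (nu e)^-1 * mdist (delta e x u) (delta e x v).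

End DilatationStructure.

Section GromovHausdorff.
Context {R : realType}.

Record pcms := PCMS {
  pcms_sort :> metricType R ;
  pcms_pt : pcms_sort ;
  pcms_compact : compact [set: pcms_sort]
}.

Definition mu_dense (Y : pcms) (mu : R) (S : set Y) : Prop :=
  forall y : Y, exists2 s, S s & mdist y s <= mu.

Definition GH_admissible (Y Z : pcms) (mu : R) : Prop :=
  0 < mu /\
  exists rho : set (Y * Z),
    [/\ mu_dense mu (fst @` rho), mu_dense mu (snd @` rho),
        rho (pcms_pt Y, pcms_pt Z) &
        forall y z y' z', rho (y, z) -> rho (y', z') ->
          `|mdist z z' - mdist y y'| <= mu].

Definition GH_dist (Y Z : pcms) : R := inf [set mu | GH_admissible Y Z mu].

Definition pointed_isometry (Y Z : pcms) (f : Y -> Z) : Prop :=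
  [/\ forall y y', mdist (f y) (f y') = mdist y y',
      forall z, exists y, f y = z & f (pcms_pt Y) = pcms_pt Z].

Definition isometric (Y Z : pcms) : Prop :=
  exists f : Y -> Z, pointed_isometry f.

Lemma isometric_refl (Y : pcms) : isometric Y Y.
Proof. by exists id; split => // y; exists y. Qed.

Lemma isometric_sym (Y Z : pcms) : isometric Y Z -> isometric Z Y.
Proof.
move=> [f [fd fs fp]].
have [g gK] : {g : Z -> Y | forall z, f (g z) = z}.
  by exists (fun z => projT1 (cid (fs z))) => z; case: cid.
have fI y y' : f y = f y' -> y = y'.
  by move=> e; apply: mdist_positivity; rewrite -fd e mdistxx.
exists g; split.
- by move=> z z'; rewrite -fd !gK.
- by move=> y; exists (f y); apply: fI; rewrite gK.
- by apply: fI; rewrite gK fp.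
Qed.

Lemma isometric_trans (X Y Z : pcms) :
  isometric X Y -> isometric Y Z -> isometric X Z.
Proof.
move=> [f [fd fs fp]] [g [gd gs gp]].
exists (g \o f); split=> [y y'|z|] /=.
- by rewrite gd fd.
- by have [y <-] := gs z; have [x <-] := fs y; exists x.
- by rewrite fp gp.
Qed.

(* Isometry classes are predicates on [pcms]: the quotients of
   [generic_quotient] would need [pcms] to be a [choiceType], which its
   universe level forbids. *)
Definition CMS : Type :=
  {C : pcms -> Prop | exists Y : pcms, C = isometric Y}.

Definition iso_class (Y : pcms) : CMS :=
  exist _ (isometric Y) (ex_intro _ Y erefl).

Lemma iso_classP (Y Z : pcms) : iso_class Y = iso_class Z <-> isometric Y Z.
Proof.
split=> [/(congr1 sval) /= ->|YZ]; first exact: isometric_refl.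
apply: eq_exist => /=; apply/funext => T; apply/propext; split => h.
- exact: isometric_trans (isometric_sym YZ) h.
- exact: isometric_trans YZ h.
Qed.

Definition CMS_dist (p q : CMS) : R :=
  inf [set mu | exists Y Z : pcms,
         [/\ p = iso_class Y, q = iso_class Z & GH_admissible Y Z mu]].

Lemma GH_admissible_sym (Y Z : pcms) mu :
  GH_admissible Y Z mu -> GH_admissible Z Y mu.
Proof.
move=> [mu0 [rho [d1 d2 pt dis]]]; split=> //.
exists [set p | rho (p.2, p.1)]; split => //.
- move=> z; have [_ [[y z'] ryz <-] /= dz] := d2 z.
  by exists z' => //; exists (z', y).
- move=> y; have [_ [[y' z] ryz <-] /= dy] := d1 y.
  by exists y' => //; exists (z, y').
- by move=> z y z' y' /= r1 r2; rewrite distrC; exact: dis.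
Qed.

Lemma GH_admissible_isometric (Y Y' Z : pcms) mu :
  isometric Y Y' -> GH_admissible Y Z mu -> GH_admissible Y' Z mu.
Proof.
move=> [f [fd fs fp]] [mu0 [rho [d1 d2 pt dis]]]; split=> //.
exists [set p | exists2 y, rho (y, p.2) & f y = p.1]; split.
- move=> y'; have [y <-] := fs y'.
  have [_ [[y0 z] ryz <-] /= dy] := d1 y.
  by exists (f y0); [exists (f y0, z) => //; exists y0|rewrite fd].
- move=> z; have [_ [[y z'] ryz <-] /= dz] := d2 z.
  by exists z' => //; exists (f y, z') => //; exists y.
- by exists (pcms_pt Y).
- move=> y1 z1 y2 z2 /= [u ru <-] [v rv <-]; rewrite fd; exact: dis.
Qed.

Lemma CMS_distE (Y Z : pcms) :
  CMS_dist (iso_class Y) (iso_class Z) = GH_dist Y Z.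
Proof.
rewrite /CMS_dist /GH_dist; congr inf; apply/seteqP; split=> mu /=; last first.
  by exists Y, Z.
move=> [Y' [Z' [/iso_classP hY /iso_classP hZ adm]]].
apply: GH_admissible_isometric (isometric_sym hY) _.
apply/GH_admissible_sym/(GH_admissible_isometric (isometric_sym hZ)).
exact/GH_admissible_sym.
Qed.

(* [is_class S rho x p] means p = [S, rho, x]: in particular rho restricts to a
   distance on the set S, and S is compact for this distance. *)
Definition is_class (T : Type) (S : set T) (rho : T -> T -> R) (x : T)
    (p : CMS) : Prop :=
  S x /\
  exists (Y : pcms) (f : T -> Y),
    [/\ p = iso_class Y,
        forall u v, S u -> S v -> mdist (f u) (f v) = rho u v,
        forall u v, S u -> S v -> f u = f v -> u = v,
        f @` S = [set: Y] & f x = pcms_pt Y].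

(* A curve is a function on R, of which only the restriction to [0, a]
   matters. For P b = iso_class Y, the class q below is the rescaled unit ball
   [closed ball of radius 1 for e^-1 d, e^-1 d, base point] of Y. *)
Definition metric_profile (a : R) (P : R -> CMS) : Prop :=
  CMS_dist (P b) (P 0) @[b --> 0^'+] --> (0 : R) /\
  forall b, 0 <= b <= a ->
    exists O : R -> R,
      [/\ forall e, 0 < O e, O e @[e --> 0^'+] --> (0 : R) &
        forall (e : R) (Y : pcms), 0 < e <= 1 -> P b = iso_class Y ->
          exists2 q : CMS,
            is_class [set y : Y | e^-1 * mdist (pcms_pt Y) y <= 1]
              (fun u v : Y => e^-1 * mdist u v) (pcms_pt Y) q &
            CMS_dist (P (e * b)) q <= O e].

End GromovHausdorff.
Arguments pcms : clear implicits.
Arguments CMS : clear implicits.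

(* Main.v *)
(* Everything happens at the fixed point x, on the ball D = {d^x(x, .) <= 1}.
   Letting the outer coefficient tend to 0 in A2 and A3 shows that d^x is
   homogeneous under delta_m; for nu m >= 1 one uses delta_{m^-1} instead.

   D is compact: for small m, delta_m maps D into a small compact ball, and the
   continuous extension of A1 to the closure of the domain carries limit points
   back through delta_{m^-1}.  Hence the curve is well defined, and by A3 it
   tends to the class of (D, d^x) up to the relation d^x = 0.

   For the profile property, each ball of radius e for the distance of index b,
   rescaled by 1/e, is matched with (D, d^x) by a dilatation of coefficient
   slightly larger than e.  Only the points close to the unit sphere can fall
   outside; they are recovered because the points of d^x-norm at most 1 - kappa
   are dense in D up to a prescribed error: a homothety h of D of ratio close to
   1 maps D into such points, and by the pigeonhole principle some iterate
   h^k u, k >= 1, returns close to u. *)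
Require Import Defs.
From HB Require Import structures.
From mathcomp Require Import all_boot all_order all_algebra.
From mathcomp Require Import all_classical all_reals all_analysis.
From mathcomp Require Import ring lra.

Set Implicit Arguments.
Unset Strict Implicit.
Unset Printing Implicit Defensive.

Import Order.TTheory GRing.Theory Num.Theory.
Import numFieldNormedType.Exports.

Local Open Scope classical_set_scope.
Local Open Scope ring_scope.

(** * Compact metric quotients of pseudo-distances, and bounds on the Gromov-Hausdorff distance *)

Section PseudoDistance.
Context {R : realType}.

Record pseudo_dist_on (T : Type) (S : set T) (rho : T -> T -> R) : Prop := {
  pdistxx : forall u, S u -> rho u u = 0 ;
  pdist_sym : forall u v, S u -> S v -> rho u v = rho v u ;
  pdist_triangle : forall u v w, S u -> S v -> S w ->
    rho u w <= rho u v + rho v w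
}.

Lemma pdist_ge0 (T : Type) (S : set T) (rho : T -> T -> R) u v :
  pseudo_dist_on S rho -> S u -> S v -> 0 <= rho u v.
Proof.
move=> h Su Sv; have := pdist_triangle h Su Sv Su.
by rewrite (pdistxx h Su) (pdist_sym h Sv Su); lra.
Qed.

(* rho may vanish off the diagonal, so f need not be injective on S. *)
Definition represents (T : Type) (S : set T) (rho : T -> T -> R) (x : T)
    (Y : pcms R) (f : T -> Y) : Prop :=
  [/\ forall u v, S u -> S v -> mdist (f u) (f v) = rho u v,
      f @` S = [set: Y] & f x = pcms_pt Y].

Section Quotient.
Context (T : choiceType) (S : set T) (rho : T -> T -> R) (x : T).
Hypothesis rhoP : pseudo_dist_on S rho.

(** [xget] selects a point that depends only on the set, so points at [rho]-distance 0 get the same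
    representative; the fixed points of this map in [S] form the quotient. *)
Definition pdist_rep (u : T) : T := xget x [set v | S v /\ rho u v = 0].

Lemma pdist_repP u : S u -> S (pdist_rep u) /\ rho u (pdist_rep u) = 0.
Proof.
move=> Su; have := @xgetPex _ x [set v | S v /\ rho u v = 0]; apply.
by exists u; split; [|exact: pdistxx rhoP _ _].
Qed.

Lemma pdist_congr u v u' v' : S u -> S v -> S u' -> S v' ->
  rho u u' = 0 -> rho v v' = 0 -> rho u v = rho u' v'.
Proof.
move=> Su Sv Su' Sv' e1 e2; apply/eqP; rewrite eq_le; apply/andP; split.
  have := pdist_triangle rhoP Su Su' Sv; have := pdist_triangle rhoP Su' Sv' Sv.
  by rewrite (pdist_sym rhoP Sv' Sv) e1 e2; lra.
have := pdist_triangle rhoP Su' Su Sv'; have := pdist_triangle rhoP Su Sv Sv'.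
by rewrite (pdist_sym rhoP Su' Su) e1 e2; lra.
Qed.

Lemma pdist_rep_eq u v : S u -> S v -> rho u v = 0 ->
  pdist_rep u = pdist_rep v.
Proof.
move=> Su Sv uv; congr xget; apply/seteqP.
by split=> w [Sw /=]; rewrite (pdist_congr Su Sw Sv Sw)// (pdistxx rhoP).
Qed.

(* The proof is an argument so that the metric instance can be inferred. *)
Definition pdist_quotient (_ : pseudo_dist_on S rho) : Type :=
  {u : T | `[< S u /\ pdist_rep u = u >]}.

HB.instance Definition _ := Choice.on (pdist_quotient rhoP).

Let quotientP (y : pdist_quotient rhoP) :
  S (val y) /\ pdist_rep (val y) = val y.
Proof. exact/asboolP/(valP y). Qed.

Let qdist (y z : pdist_quotient rhoP) := rho (val y) (val z).

Let qdistxx y : qdist y y = 0.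
Proof. by apply: (pdistxx rhoP); case: (quotientP y). Qed.

Let qdist_positivity y z : qdist y z = 0 -> y = z.
Proof.
have [Sy ry] := quotientP y; have [Sz rz] := quotientP z.
by move=> yz; apply: val_inj; rewrite -ry -rz; exact: pdist_rep_eq.
Qed.

Let qdist_sym y z : qdist y z = qdist z y.
Proof.
by apply: (pdist_sym rhoP); [case: (quotientP y)|case: (quotientP z)].
Qed.

Let qdist_triangle z y t : qdist y t <= qdist y z + qdist z t.
Proof.
by apply: (pdist_triangle rhoP); [case: (quotientP y)|case: (quotientP z)|
  case: (quotientP t)].
Qed.

HB.instance Definition _ := @isMetric.Build R (pdist_quotient rhoP) qdist
  qdistxx qdist_positivity qdist_sym qdist_triangle.

Lemma mdist_quotientE (y z : pdist_quotient rhoP) :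
  mdist y z = rho (val y) (val z).
Proof. by []. Qed.

End Quotient.

(** The last hypothesis makes the projection to the quotient continuous on [S], so the quotient is
    compact as the image of [S]. *)
Lemma pcms_of_pseudo_dist (T : topologicalType) (S : set T)
    (rho : T -> T -> R) (x : T) :
  pseudo_dist_on S rho -> S x -> compact S ->
  (forall l, S l -> rho l u @[u --> within S (nbhs l)] --> (0 : R)) ->
  exists (Y : pcms R) (f : T -> Y), represents S rho x f.
Proof.
move=> rhoP Sx cS rho0; pose Q : metricType R := pdist_quotient x rhoP.
have inQ u : S u -> `[< S (pdist_rep S rho x u) /\
    pdist_rep S rho x (pdist_rep S rho x u) = pdist_rep S rho x u >].
  move=> Su; have [Sr r0] := pdist_repP x rhoP Su; apply/asboolP; split=> //.
  exact/esym/(pdist_rep_eq x rhoP Su Sr).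
pose q0 : Q :=
  exist (fun u => `[< S u /\ pdist_rep S rho x u = u >] : Prop) _ (inQ x Sx).
pose f (u : T) : Q := insubd q0 (pdist_rep S rho x u).
have valf u : S u -> val (f u) = pdist_rep S rho x u.
  by move=> Su; rewrite /f val_insubd inQ.
have fd u v : S u -> S v -> mdist (f u) (f v) = rho u v.
  move=> Su Sv; rewrite mdist_quotientE !valf//.
  have [Sru ru] := pdist_repP x rhoP Su; have [Srv rv] := pdist_repP x rhoP Sv.
  by rewrite -(pdist_congr rhoP Su Sv Sru Srv).
have fS : f @` S = [set: Q].
  apply/seteqP; split=> // y _; have /asboolP[Sy ry] := valP y.
  by exists (val y) => //; apply: val_inj; rewrite valf.
have fC : {within S, continuous f}.
  apply/(@subspace_continuousP _ S Q f) => l Sl.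
  apply/(@metricType_numDomainType.cvgrPdist_lt _ Q) => e e0.
  have /cvgrPdist_lt/(_ e e0) := rho0 l Sl.
  rewrite !near_withinE; apply: filterS => u + Su.
  move=> /(_ Su); rewrite fd// sub0r normrN.
  by rewrite ger0_norm// (pdist_ge0 rhoP).
have cQ : compact [set: Q] by rewrite -fS; exact: continuous_compact.
by exists (PCMS (f x) cQ), f.
Qed.

Lemma mdist_continuous (T : metricType R) (p : T) : continuous (mdist p).
Proof.
move=> l; apply/cvgrPdist_le => e e0.
have /(@metricType_numDomainType.cvgrPdist_le _ T)/(_ e e0) :
  id y @[y --> l] --> l by [].
apply: filterS => u lu; rewrite ler_norml.
have := metric_triangle p l u; have := metric_triangle p u l.
by rewrite (metric_sym u l) /=; move: lu => /=; lra.
Qed.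

Lemma cball_closed (T : metricType R) (p : T) r : closed (cball p r).
Proof.
apply: (@preimage_closed _ _ (mdist p) [set s | s <= r]); last exact: closed_le.
by move=> l _; exact: mdist_continuous.
Qed.

Lemma represents_class (T : Type) (S : set T) (rho : T -> T -> R) (x : T)
    (Y : pcms R) (f : T -> Y) :
  represents S rho x f -> S x ->
  (forall u v, S u -> S v -> rho u v = 0 -> u = v) ->
  is_class S rho x (iso_class Y).
Proof.
move=> [fd fS fx] Sx rho_eq0; split=> //; exists Y, f; split=> // u v Su Sv fuv.
by apply: rho_eq0 => //; rewrite -fd// fuv mdistxx.
Qed.

Lemma rescaled_ball_class (Y : pcms R) (e : R) : 0 < e ->
  exists (Z : pcms R) (h : Y -> Z),
    represents [set y : Y | e^-1 * mdist (pcms_pt Y) y <= 1]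
      (fun u v => e^-1 * mdist u v) (pcms_pt Y) h.
Proof.
move=> e0; have ei0 : 0 < e^-1 by rewrite invr_gt0.
apply: pcms_of_pseudo_dist; first split.
- by move=> u _; rewrite mdistxx mulr0.
- by move=> u v _ _; rewrite metric_sym.
- by move=> u v w _ _ _; rewrite -mulrDr ler_pM2l// metric_triangle.
- by rewrite /= mdistxx mulr0.
- apply: (subclosed_compact _ (@pcms_compact _ Y)) => //.
  have -> : [set y : Y | e^-1 * mdist (pcms_pt Y) y <= 1] = cball (pcms_pt Y) e.
    by apply/seteqP; split => y; rewrite /cball /= ler_pdivrMl// mulr1.
  exact: cball_closed.
- move=> l _; apply: cvg_within_filter.
  suff : e^-1 * mdist l u @[u --> l] --> e^-1 * mdist l l.
    by rewrite mdistxx mulr0.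
  by apply: cvgM; [exact: cvg_cst|exact: mdist_continuous].
Qed.

(** A profile is tested on every representative [Y'] of a class, while the rescaled ball is built
    for a single [Y]; composing with the isometry transfers it. *)
Lemma rescaled_ball_is_class (Y Y' Z : pcms R) (h : Y -> Z) (e : R) : 0 < e ->
  represents [set y : Y | e^-1 * mdist (pcms_pt Y) y <= 1]
    (fun u v => e^-1 * mdist u v) (pcms_pt Y) h ->
  isometric Y' Y ->
  is_class [set y : Y' | e^-1 * mdist (pcms_pt Y') y <= 1]
    (fun u v => e^-1 * mdist u v) (pcms_pt Y') (iso_class Z).
Proof.
move=> e0 [hd hS hp] [g [gd gs gp]].
have ballg y : e^-1 * mdist (pcms_pt Y') y <= 1 ->
    e^-1 * mdist (pcms_pt Y) (g y) <= 1 by rewrite -gp gd.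
apply: (@represents_class _ _ _ _ Z (h \o g)).
- split=> [u v Su Sv||] /=.
  + by rewrite hd ?gd//; exact: ballg.
  + apply/seteqP; split=> // z _.
    have [y Sy <-] : (h @` [set y : Y | e^-1 * mdist (pcms_pt Y) y <= 1]) z.
      by rewrite hS.
    by have [y' gy'] := gs y; exists y'; rewrite /= ?gy'// -gd gy' gp.
  + by rewrite gp.
- by rewrite /= mdistxx mulr0.
- move=> u v _ _ /eqP; rewrite mulf_eq0 gt_eqF ?invr_gt0//= => /eqP.
  exact: mdist_positivity.
Qed.

(** The relation [r] is pushed forward by [f] and [g]. Being total on both sides, it has surjective
    projections, so only the distortion constrains [mu]. *)
Lemma GH_admissible_relation (T1 T2 : Type) (S1 : set T1) (S2 : set T2)
    (rho1 : T1 -> T1 -> R) (rho2 : T2 -> T2 -> R) (x1 : T1) (x2 : T2)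
    (Y Z : pcms R) (f : T1 -> Y) (g : T2 -> Z)
    (r : T1 -> T2 -> Prop) (mu : R) :
  represents S1 rho1 x1 f -> represents S2 rho2 x2 g -> 0 < mu ->
  S1 x1 -> S2 x2 -> r x1 x2 ->
  (forall u, S1 u -> exists2 w, S2 w & r u w) ->
  (forall w, S2 w -> exists2 u, S1 u & r u w) ->
  (forall u w u' w', S1 u -> S2 w -> S1 u' -> S2 w' -> r u w -> r u' w' ->
     `|rho2 w w' - rho1 u u'| <= mu) ->
  GH_admissible Y Z mu.
Proof.
move=> [fd fS fx] [gd gS gx] mu0 Sx1 Sx2 rx dom im dis; split=> //.
exists [set p | exists u w, [/\ S1 u, S2 w, r u w & p = (f u, g w)]]; split.
- move=> y; have [u Su <-] : (f @` S1) y by rewrite fS.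
  exists (f u); last by rewrite mdistxx ltW.
  by have [w Sw ruw] := dom u Su; exists (f u, g w) => //; exists u, w.
- move=> z; have [w Sw <-] : (g @` S2) z by rewrite gS.
  exists (g w); last by rewrite mdistxx ltW.
  by have [u Su ruw] := im w Sw; exists (f u, g w) => //; exists u, w.
- by exists x1, x2; rewrite fx gx.
- move=> _ _ _ _ [u [w [Su Sw ruw [-> ->]]]] [u' [w' [Su' Sw' ruw' [-> ->]]]].
  by rewrite fd// gd//; exact: dis.
Qed.

Lemma CMS_dist_ge0 (p q : CMS R) : 0 <= CMS_dist p q.
Proof.
rewrite /CMS_dist; set E := [set mu | _].
have [->|/set0P E0] := eqVneq E set0; first by rewrite inf0.
by apply: lb_le_inf => // mu [Y [Z [_ _ [/ltW]]]].
Qed.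

Lemma CMS_dist_le (Y Z : pcms R) (mu : R) : GH_admissible Y Z mu ->
  CMS_dist (iso_class Y) (iso_class Z) <= mu.
Proof.
move=> adm; apply: ge_inf; last by exists Y, Z.
by exists 0 => m [Y' [Z' [_ _ [/ltW]]]].
Qed.

End PseudoDistance.

(** * Convergence of composites, pairs and distances along a filter *)

Lemma within_comp_cvg (I : Type) (T Z : topologicalType) (F : set_system I)
    (D : set T) (f : T -> Z) (h : I -> T) (p : T) : Filter F ->
  {within D, continuous f} -> D p -> h @ F --> p ->
  (\forall i \near F, D (h i)) -> f (h i) @[i --> F] --> f p.
Proof.
move=> FF /subspace_continuousP fD Dp hp hD.
apply: cvg_trans (fD p Dp) => P /=; rewrite /nbhs/= => Pp.
have hP : \forall i \near F, D (h i) -> P (f (h i)) by exact: hp Pp.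
by apply: filterS2 hD hP => i Di; exact.
Qed.

Lemma cvg_pair_nbhs (I : Type) (S T : topologicalType) (F : set_system I)
    (f : I -> S) (g : I -> T) (a : S) (b : T) : Filter F ->
  f @ F --> a -> g @ F --> b -> (f i, g i) @[i --> F] --> (a, b).
Proof.
by move=> FF; exact: (@cvg_pair _ _ _ F (nbhs a) (nbhs b) _ _ _ f g).
Qed.

Lemma mdist_cvg (R : realType) (T : metricType R) (I : Type)
    (F : set_system I) (f g : I -> T) (a b : T) : Filter F ->
  f @ F --> a -> g @ F --> b -> mdist (f i) (g i) @[i --> F] --> mdist a b.
Proof.
move=> FF /(@metricType_numDomainType.cvgrPdist_le _ T) fa.
move=> /(@metricType_numDomainType.cvgrPdist_le _ T) gb.
apply/cvgrPdist_le => e e0; have e2 : 0 < e / 2 by rewrite divr_gt0.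
apply: filterS2 (fa _ e2) (gb _ e2) => i ai bi; rewrite ler_norml.
have := metric_triangle a (f i) b; have := metric_triangle (f i) (g i) b.
have := metric_triangle (f i) a (g i); have := metric_triangle a b (g i).
by rewrite (metric_sym (f i) a) (metric_sym (g i) b) /=; lra.
Qed.

Lemma mulr_norm_gt0 (R : realDomainType) (c t : R) : 0 < c ->
  c * `|t| = `|c * t|.
Proof. by move=> c0; rewrite normrM gtr0_norm. Qed.

(** * Dilatations at the fixed point [x] *)

Section TangentSpace.
Context (R : realType) (G : commTopGroupType) (nu : G -> R) (X : metricType R)
  (A B : R) (U : X -> set X) (V W : G -> X -> set X) (delta : G -> X -> X -> X)
  (dx : X -> X -> X -> R).
Hypotheses (nu_modulus : is_modulus nu)
  (hA0 : dilatation_A0 nu A B U V W delta)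
  (hA1 : dilatation_A1 nu U W delta)
  (hA2 : dilatation_A2 nu A delta)
  (hA3 : dilatation_A3 nu A delta dx).
Variable x : X.

Let nu_gt0 := modulus_gt0 nu_modulus.
Let nuM := modulusM nu_modulus.

Lemma near_to0P (P : G -> Prop) :
  (\forall e \near to0 nu, P e) <->
  exists2 a, 0 < a & forall g, nu g < a -> P g.
Proof. by split=> -[a a0 aP]; exists a. Qed.

#[local] Instance to0_filter : Filter (to0 nu).
Proof.
apply: filter_from_filter; first by exists 1 => /=.
move=> a b /= a0 b0; exists (Num.min a b); first by rewrite /= lt_min a0.
by move=> g /=; rewrite lt_min => /andP[].
Qed.

Lemma modulus1 : nu 1%g = 1.
Proof.
have := nuM 1%g 1%g; rewrite mulg1 => h.
apply: (mulfI (lt0r_neq0 (nu_gt0 1%g))).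
by rewrite -h mulr1.
Qed.

Lemma modulusV g : nu (g^-1)%g = (nu g)^-1.
Proof.
apply: (mulfI (lt0r_neq0 (nu_gt0 g))); rewrite -nuM mulgV modulus1 divff//.
exact: lt0r_neq0.
Qed.

Lemma modulus_small a : 0 < a -> exists g, nu g < a.
Proof.
move=> a0; have : inf (range nu) < a by rewrite (modulus_inf nu_modulus).
move=> /inf_lt[|_ [g _ <-]]; last by exists g.
by exists (nu 1%g), 1%g.
Qed.

Lemma cball_dom u : cball x A u -> U x u.
Proof. exact: A0_cball hA0 _ _. Qed.

Lemma cball_center : cball x A x.
Proof. by rewrite /cball /= mdistxx; have := A0_gt1 hA0; lra. Qed.

(** Here and in the next two lemmas an axiom (A1, A3, A2 in turn) is specialised to the compact set
    {x} and multiplied by the modulus, so that errors can be added. *)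
Lemma dil_base_small eta : 0 < eta ->
  exists2 a, 0 < a & forall g, nu g < a ->
    mdist x (delta g x x) <= eta * nu g.
Proof.
move=> eta0; have /near_to0P[a a0 aP] := A1_base hA1 (@compact_set1 X x) eta0.
by exists a => // g /aP/(_ x erefl); rewrite mulrC ler_pdivrMr.
Qed.

Lemma dil_dist_approx eta : 0 < eta ->
  exists2 a, 0 < a & forall g, nu g < a -> forall u v,
    cball x A u -> cball x A v ->
    `|mdist (delta g x u) (delta g x v) - nu g * dx x u v| <= eta * nu g.
Proof.
move=> eta0; have /near_to0P[a a0 aP] := hA3 (@compact_set1 X x) eta0.
exists a => // g /aP gP u v Au Av; have := gP x u v erefl Au Av.
rewrite -(ler_pM2l (nu_gt0 g)) mulr_norm_gt0// mulrBr mulrA.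
by rewrite divff ?mul1r 1?(mulrC _ eta)// gt_eqF.
Qed.

Lemma dil_comp_approx eta : 0 < eta ->
  exists2 a, 0 < a & forall e m u v, nu e < 1 -> nu m < 1 -> nu e * nu m < a ->
    cball x A u -> cball x A v ->
    `|mdist (delta e x (delta m x u)) (delta e x (delta m x v))
      - mdist (delta (e * m)%g x u) (delta (e * m)%g x v)|
    <= eta * (nu e * nu m).
Proof.
move=> eta0; have [rem [rem0 remlim remP]] := hA2 (@compact_set1 X x).
move: remlim => /cvgrPdist_le/(_ _ eta0)/near_to0P[a a0 aP].
exists a => // e m u v e1 m1 ema Au Av; rewrite -nuM.
have := remP x e m u v erefl e1 m1 Au Av.
rewrite ler_pdivrMl// mulrC => /le_trans.
apply; rewrite ler_pM2r//; have := aP (e * m)%g; rewrite nuM => /(_ ema).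
by rewrite sub0r normrN ger0_norm// ltW.
Qed.

Lemma dil_cover g w : nu g < 1 -> mdist x w < nu g ->
  exists2 u, cball x A u & w = delta g x u.
Proof.
move=> g1 wg; have [cover _ _] := A0_small hA0 x g1.
have [|u Bu <-] := cover w; first by rewrite ballEmdist.
by exists u => //; move: Bu; rewrite ballEmdist /= => /ltW.
Qed.

Lemma dil_continuous g : nu g <= 1 -> {within U x, continuous (delta g x)}.
Proof. by move=> g1; have [] := A0_homeo hA0 x g1. Qed.

Lemma dil_in_dom g u : nu g < 1 -> U x u -> U x (delta g x u).
Proof.
move=> g1 Uu; have [_ _ VU] := A0_small hA0 x g1; apply: VU.
by have [<- _ _] := A0_homeo hA0 x (ltW g1); exists u.
Qed.

Lemma dil_cvg (I : Type) (F : set_system I) (m : I -> G) (g : G) u : Filter F ->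
  m @ F --> g -> nu g <= 1 -> (\forall i \near F, nu (m i) <= 1) -> U x u ->
  delta (m i) x u @[i --> F] --> delta g x u.
Proof.
move=> FF mg g1 m1 Uu.
apply: (@within_comp_cvg I (G * X * X)%type X F (dil_dom nu U W)
  (fun p => delta p.1.1 p.1.2 p.2) (fun i => (m i, x, u)) (g, x, u)).
- exact: A1_continuous hA1.
- by rewrite /dil_dom /= g1.
- by apply: cvg_pair_nbhs; [apply: cvg_pair_nbhs => //|]; exact: cvg_cst.
- by apply: filterS m1 => i mi1; rewrite /dil_dom /= mi1.
Qed.

(** * The limit distance d^x: pseudo-distance and homogeneity *)

Lemma dx_pseudo_dist : pseudo_dist_on (cball x A) (dx x).
Proof.
split=> [u Au|u v Au Av|u v w Au Av Aw].
(* Each property holds exactly for d(delta_g u, delta_g v) / nu g, which approximates d^x to any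
   precision once [nu g] is small. *)
- apply/eqP; rewrite -normr_le0; apply/ler_addgt0Pl => e e0; rewrite addr0.
  have [a a0 aP] := dil_dist_approx e0; have [g /aP] := modulus_small a0.
  move=> /(_ u u Au Au); rewrite mdistxx sub0r normrN normrM.
  by rewrite (gtr0_norm (nu_gt0 g)) mulrC ler_pM2r.
- apply/eqP; rewrite -subr_eq0 -normr_le0; apply/ler_addgt0Pl => e e0.
  rewrite addr0; have e2 : 0 < e / 2 by rewrite divr_gt0.
  have [a a0 aP] := dil_dist_approx e2; have [g ga] := modulus_small a0.
  have := aP g ga u v Au Av; have := aP g ga v u Av Au.
  rewrite (metric_sym (delta g x v)) -(ler_pM2l (nu_gt0 g) _ e).
  rewrite mulr_norm_gt0// mulrBr !ler_norml; lra.
- apply/ler_addgt0Pl => e e0; have e3 : 0 < e / 3 by rewrite divr_gt0.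
  have [a a0 aP] := dil_dist_approx e3; have [g ga] := modulus_small a0.
  rewrite -(ler_pM2l (nu_gt0 g)) !mulrDr.
  have := aP g ga u v Au Av; have := aP g ga v w Av Aw.
  have := aP g ga u w Au Aw.
  have := metric_triangle (delta g x u) (delta g x v) (delta g x w).
  rewrite !ler_norml; lra.
Qed.

(* The closure covers m with nu m = 1: A2 passes to the limit in its inner
   coefficient, before the outer one tends to 0. *)
Lemma dx_homogeneous m u v : closure [set g : G | nu g < 1] m ->
  cball x A u -> cball x A v ->
  cball x A (delta m x u) -> cball x A (delta m x v) ->
  dx x (delta m x u) (delta m x v) = nu m * dx x u v.
Proof.
move=> clm Au Av Amu Amv.
have m1 : nu m <= 1.
  suff : [set g | nu g <= 1] m by [].
  have /closure_id -> : closed [set g | nu g <= 1].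
    apply: (@preimage_closed _ _ nu [set s | s <= 1]); last exact: closed_le.
    by move=> l _; exact: modulus_continuous nu_modulus _.
  by apply: closureS clm => g /= /ltW.
have UX := cball_dom.
apply/eqP; rewrite -subr_eq0 -normr_le0; apply/ler_addgt0Pl => e e0.
rewrite addr0; have e3 : 0 < e / 3 by rewrite divr_gt0.
have [a a0 aP] := dil_dist_approx e3; have [b b0 bP] := dil_comp_approx e3.
have ab0 : 0 < Num.min 1 (Num.min a b) by rewrite !lt_min ltr01 a0 b0.
have [g] := modulus_small ab0; rewrite !lt_min => /andP[g1 /andP[ga gb]].
have g0 := nu_gt0 g; have nm0 := nu_gt0 m.
have gma : nu (g * m)%g < a by rewrite nuM; nra.
have := aP g ga _ _ Amu Amv; have := aP (g * m)%g gma _ _ Au Av.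
(* A3 at [g] for the images under delta_m, A3 at [g * m] for [u] and [v], and this comparison each
   cost at most e / 3 after division by [nu g]. *)
suff : `|mdist (delta g x (delta m x u)) (delta g x (delta m x v))
      - mdist (delta (g * m)%g x u) (delta (g * m)%g x v)| <= e / 3 * nu g.
  rewrite nuM -(ler_pM2l g0 _ e) mulr_norm_gt0// mulrBr !ler_norml.
  move: (dx _ _ _) (dx _ _ _) => D1 D2; nra.
(* Coefficients of modulus < 1 tending to [m]: A2 applies to them even when [nu m = 1]. *)
pose F : set_system G := within [set h | nu h < 1] (nbhs m).
have FF : ProperFilter F.
  by apply: within_nbhs_proper.
have Fm : id @ F --> m by exact: cvg_within.
have F1 : \forall h \near F, nu h < 1 by exact: withinT.
have F1' : \forall h \near F, nu h <= 1 by apply: filterS F1 => h /ltW.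
have Fgm : (g * h)%g @[h --> F] --> (g * m)%g.
  apply: (@cvg_comp _ _ _ (fun h => (g, h)) (fun p => (p.1 * p.2)%g) F _ _
    _ (@topgroup_mul_continuous G (g, m))).
  by apply: cvg_pair_nbhs => //; exact: cvg_cst.
have lim w : cball x A w -> cball x A (delta m x w) ->
    delta g x (delta h x w) @[h --> F] --> delta g x (delta m x w).
  move=> Aw Amw; apply: (@within_comp_cvg _ _ _ F (U x) (delta g x)).
  - exact: dil_continuous (ltW g1).
  - exact: UX.
  - by apply: dil_cvg => //; exact: UX.
  - by apply: filterS F1 => h h1; apply: dil_in_dom => //; exact: UX.
have limg w : cball x A w ->
    delta (g * h)%g x w @[h --> F] --> delta (g * m)%g x w.
  move=> Aw; apply: dil_cvg => //; last exact: UX.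
  - by rewrite nuM; nra.
  - by apply: filterS F1 => h h1; rewrite nuM; have := nu_gt0 h; nra.
apply: (@cvgr_to_le _ F _ _ (fun h =>
    `|mdist (delta g x (delta h x u)) (delta g x (delta h x v))
      - mdist (delta (g * h)%g x u) (delta (g * h)%g x v)|)).
  apply: cvg_norm; apply: cvgB; apply: mdist_cvg;
    by [exact: lim|exact: limg].
apply: filterS F1 => h h1; have h0 := nu_gt0 h.
apply: le_trans (bP g h u v _ _ _ _ _) _ => //; first by nra.
by rewrite ler_pM2l//; nra.
Qed.

Lemma closure_modulusV m : closure [set g : G | 1 < nu g] m ->
  closure [set g : G | nu g < 1] (m^-1)%g.
Proof.
move=> clm N /(@topgroup_inv_continuous G m)/clm[g [/= g1 Ng]].
by exists (g^-1)%g; split=> //=; rewrite modulusV invf_lt1.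
Qed.

Lemma dx_homogeneousV m u v : closure [set g : G | nu g < 1] (m^-1)%g ->
  cball x A u -> cball x A v ->
  cball x A (delta m x u) -> cball x A (delta m x v) ->
  delta (m^-1)%g x (delta m x u) = u -> delta (m^-1)%g x (delta m x v) = v ->
  dx x u v = (nu m)^-1 * dx x (delta m x u) (delta m x v).
Proof.
move=> clm Au Av Amu Amv mu mv; rewrite -modulusV -dx_homogeneous ?mu ?mv//.
Qed.

(** A0 gives that delta_m inverts delta_{m^-1} on [U x]. Hence delta_m takes the same value at
    delta_{m^-1} (delta_m u) and at u, and it is injective on [W m x]. *)
Lemma dilVK m u : 1 < nu m -> W m x u -> cball x A (delta m x u) ->
  delta (m^-1)%g x (delta m x u) = u.
Proof.
move=> m1 Wu Amu; have [_ _ [_ _ [g [_ gK]]] VW] := A0_large hA0 x m1.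
have mV1 : nu (m^-1)%g < 1 by rewrite modulusV invf_lt1.
have Up := cball_dom Amu; have [_] := A0_inv hA0 (ltW mV1) Up.
rewrite invgK => mK; rewrite -[LHS]gK ?mK ?gK//.
by apply: VW; have [<- _ _] := A0_homeo hA0 x (ltW mV1); exists (delta m x u).
Qed.

Lemma dx_scaling u v m : mdist x u <= 1 -> mdist x v <= 1 ->
  A2_determined nu m ->
  dil_dom nu U W (m, x, u) -> dil_dom nu U W (m, x, v) ->
  cball x A (delta m x u) -> cball x A (delta m x v) ->
  dx x u v = (nu m)^-1 * dx x (delta m x u) (delta m x v).
Proof.
move=> u1 v1 mdet; rewrite /dil_dom /= => domu domv Amu Amv.
have A1 := A0_gt1 hA0.
have Au : cball x A u by rewrite /cball /=; lra.
have Av : cball x A v by rewrite /cball /=; lra.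
have direct : closure [set g : G | nu g < 1] m ->
    dx x u v = (nu m)^-1 * dx x (delta m x u) (delta m x v).
  by move=> clm; rewrite dx_homogeneous// mulKf// gt_eqF.
have [m1|m1|m1] := ltgtP (nu m) 1.
- by apply: direct; exact: subset_closure.
- move: domu domv; rewrite leNgt m1 /= => Wu Wv.
  apply: dx_homogeneousV => //; [|exact: dilVK|exact: dilVK].
  by apply: subset_closure => /=; rewrite modulusV invf_lt1.
- have [Uu Uv] : U x u /\ U x v by move: domu domv; rewrite m1 lexx.
  move: mdet => [m_1|].
    by rewrite m_1 !(A1_id hA1)// modulus1 invr1 mul1r.
  (* Either [m] is a limit of coefficients of modulus < 1, or it is a limit of coefficients of
     modulus > 1 and then [m^-1] is of the first kind. *)
  have -> : [set g : G | nu g != 1] =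
      [set g : G | nu g < 1] `|` [set g : G | 1 < nu g].
    by apply/seteqP; split=> g /=; rewrite neq_lt => /orP.
  rewrite closureU => -[|/closure_modulusV clm]; first exact: direct.
  apply: dx_homogeneousV => //;
    by apply: (A0_inv hA0 _ _).2 => //; rewrite m1.
Qed.

(** * Continuity of d^x and compactness of its unit ball [D] *)

Lemma dx_cvg (I : Type) (F : set_system I) (h : I -> X) p l : Filter F ->
  h @ F --> l -> (\forall i \near F, cball x A (h i)) -> cball x A l ->
  cball x A p -> dx x p (h i) @[i --> F] --> dx x p l.
Proof.
move=> FF hl hA Al Ap; apply/cvgrPdist_le => e e0.
have e3 : 0 < e / 3 by rewrite divr_gt0.
(* For one small [g], d^x(p, .) stays within e / 3 of d(delta_g p, delta_g .) / nu g on the ball,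
   and the latter function is continuous there. *)
have [a a0 aP] := dil_dist_approx e3.
have a1 : 0 < Num.min 1 a by rewrite lt_min ltr01.
have [g] := modulus_small a1; rewrite lt_min => /andP[g1 ga].
have dl : mdist (delta g x p) (delta g x (h i)) @[i --> F] -->
    mdist (delta g x p) (delta g x l).
  apply: mdist_cvg; first exact: cvg_cst.
  apply: (@within_comp_cvg _ _ _ F (U x) (delta g x)) => //.
  - exact: dil_continuous (ltW g1).
  - exact: cball_dom.
  - by apply: filterS hA => i; exact: cball_dom.
have g0 := nu_gt0 g; have ge : 0 < e / 3 * nu g by exact: mulr_gt0.
move: dl => /cvgrPdist_le/(_ _ ge); apply: filterS2 hA => i Ah.
have := aP g ga _ _ Ap Al; have := aP g ga _ _ Ap Ah.
rewrite -(ler_pM2l g0 _ e) mulr_norm_gt0// mulrBr !ler_norml; lra.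
Qed.

Local Notation D := (dx_unit_ball A dx x).

Lemma unit_ball_cball u : D u -> cball x A u. Proof. by case. Qed.

Lemma unit_ball_dx u : D u -> dx x x u <= 1. Proof. by case. Qed.

Lemma unit_ball_center : D x.
Proof.
by split; [|rewrite (pdistxx dx_pseudo_dist)//]; exact: cball_center.
Qed.

Lemma unit_ball_limit (F : set_system X) l : ProperFilter F -> F D ->
  F --> l -> D l.
Proof.
move=> FF FD Fl.
have FA : \forall u \near F, cball x A u by apply: filterS FD => u [].
have Al : cball x A l.
  by apply: (@closed_cvg _ _ F FF id (cball x A)) => //; exact: cball_closed.
split=> //; apply: (@cvgr_to_le _ F FF _ (dx x x)).
  by apply: (@dx_cvg _ F id) => //; exact: cball_center.
by apply: filterS FD => u [].
Qed.

Lemma dil_unit_ball_near r : 0 < r -> exists2 a, 0 < a & forall g, nu g < a ->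
  forall u, D u -> mdist x (delta g x u) < r.
Proof.
move=> r0; have [a a0 aP] := dil_base_small ltr01.
have [b b0 bP] := dil_dist_approx ltr01.
(* In [r / 3]: d(x, delta_g x) is at most [nu g], and d(delta_g x, delta_g u) at most [2 * nu g]. *)
exists (Num.min a (Num.min b (r / 3))); first by rewrite !lt_min a0 b0 divr_gt0.
move=> g; rewrite !lt_min => /andP[ga /andP[gb gr]] u [Au du].
have := aP g ga; have := bP g gb x u cball_center Au.
have := metric_triangle x (delta g x x) (delta g x u).
have g0 := nu_gt0 g; rewrite ler_norml; nra.
Qed.

Lemma unit_ball_compact : locally_compact [set: X] -> compact D.
Proof.
move=> /(_ x I) [C Cx [cC _]].
have [r r0 rC] : exists2 r, 0 < r & forall y, mdist x y < r -> C y.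
  have : nbhs x C by apply: (@filterS _ (nbhs x) _ _ _ _ Cx) => y; exact.
  rewrite -metricType_numDomainType.nbhs_nbhs_mdist => -[r /= r0 rC].
  by exists r => // y; exact: rC.
have [a a0 aP] := dil_unit_ball_near r0.
have a1 : 0 < Num.min 1 a by rewrite lt_min ltr01.
have [m] := modulus_small a1; rewrite lt_min => /andP[m1 /aP mD].
have [dbar [dbarC dbarE _]] := A1_extension hA1.
rewrite compact_ultra => F FU FD.
have [y [Cy Fy]] : C `&` cluster (delta m x @ F) !=set0.
  apply: cC; rewrite nbhs_simpl /=.
  by apply: (filterS _ FD) => u Du; apply/rC/mD.
have {}Fy : delta m x @ F --> y.
  move=> N Ny; have [//|FN] := in_ultra_setVsetC (delta m x @^-1` N) FU.
  by have [z [nNz Nz]] := Fy (~` N) N FN Ny.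
(* The points [p u] lie in the domain of delta, while their limit [q] is known only to lie in its
   closure; hence the passage to [dbar], which sends [p u] back to [u]. *)
pose p u : with_zero nu * X * X := (Some (m^-1)%g, x, delta m x u).
pose q : with_zero nu * X * X := (Some (m^-1)%g, x, y).
have pF : p @ F --> q.
  by apply: cvg_pair_nbhs => //; exact: cvg_cst.
have pdom : \forall u \near F, closure (@dil_dom0 R G nu X U W) (p u).
  apply: filterS FD => u [/cball_dom Uu _]; apply: subset_closure.
  by exists ((m^-1)%g, x, delta m x u) => //; have [] := A0_inv hA0 (ltW m1) Uu.
have qdom : closure (@dil_dom0 R G nu X U W) q.
  by apply: (closed_cvg _ (@closed_closure _ _) pdom q pF).
have : dbar (p u) @[u --> F] --> dbar q by exact: within_comp_cvg.
set l := dbar q => dl; suff Fl : F --> l.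
  by exists l; split=> //; exact: unit_ball_limit FD Fl.
apply: cvg_trans dl; apply: near_eq_cvg.
apply: filterS FD => u [/cball_dom Uu _]; rewrite /p.
by have [dom uK] := A0_inv hA0 (ltW m1) Uu; rewrite dbarE.
Qed.

(** Continuity of d^x(x, .) at [x]. It ensures later that dilatations of small coefficient map [D]
    into itself. *)
Lemma unit_ball_near : exists2 r, 0 < r & forall w, mdist x w < r -> D w.
Proof.
have nA : \forall w \near x, cball x A w.
  apply/metricType_numDomainType.nbhs_mdistP; exists 1 => //= w /ltW x1.
  by rewrite /cball /=; have := A0_gt1 hA0; lra.
have /cvgrPdist_le/(_ _ ltr01) :=
  @dx_cvg _ (nbhs x) id x x (nbhs_filter x) cvg_id nA cball_center cball_center.
rewrite (pdistxx dx_pseudo_dist cball_center) => n1.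
have : \forall w \near x, D w.
  apply: filterS2 nA n1 => w Aw; rewrite sub0r normrN => w1.
  by split=> //; exact: le_trans (ler_norm _) w1.
by move=> /metricType_numDomainType.nbhs_mdistP[r r0 rD]; exists r => // w /rD.
Qed.

(** * Finite nets and the pigeonhole principle in [D] *)

Lemma unit_ball_net eta : compact D -> 0 < eta -> exists s : seq X,
  forall u, D u -> exists2 c, c \in s & D c /\ dx x c u <= eta.
Proof.
move=> /compact_near_coveringP/near_covering_withinP cD eta0.
(* Finite sequences directed by inclusion: near-covering compactness along this filter glues the
   local one-point nets into a finite one. *)
pose F : set_system (seq X) :=
  filter_from setT (fun s : seq X => [set t : seq X | {subset s <= t}]).
have FF : Filter F.
  apply: filter_from_filter; first by exists [::].
  move=> s t _ _; exists (s ++ t) => // w /= st.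
  by split=> c cs; apply: st; rewrite mem_cat cs ?orbT.
have [|s _ sP] := cD _ F (fun (t : seq X) u =>
    exists2 c, c \in t & D c /\ dx x c u <= eta) FF.
  move=> c Dc; have [Ac _] := Dc.
  have : \forall u \near within D (nbhs c), cball x A u.
    by apply: filterS (withinT D _) => u [].
  move=> nA; have := @dx_cvg _ (within D (nbhs c)) id c c
    (within_filter _ (nbhs_filter c))
    (@cvg_within _ (nbhs c) (nbhs_filter c) D) nA Ac Ac.
  move=> /cvgrPdist_le/(_ _ eta0).
  rewrite (pdistxx dx_pseudo_dist Ac) near_withinE => nc.
  exists ([set u | D u -> `|0 - dx x c u| <= eta],
    [set t : seq X | c \in t]) => /=.
    split=> //; exists [:: c] => // t /= ct.
    by apply: ct; rewrite mem_head.
  move=> [u t] /= [cu ct] Du; exists c => //; split=> //.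
  by have := cu Du; rewrite sub0r normrN; apply: le_trans; exact: ler_norm.
by exists s => u Du; exact: (sP s).
Qed.

(** The bound [N] is uniform in [h]: it is the size of an eta / 2-net, so two of the points [h 0],
    ..., [h N] share a centre. *)
Lemma unit_ball_pigeonhole eta : compact D -> 0 < eta -> exists N : nat,
  forall h : nat -> X, (forall i, D (h i)) ->
  exists i j, [/\ (i < j <= N)%N & dx x (h i) (h j) <= eta].
Proof.
move=> cD eta0; have eta2 : 0 < eta / 2 by rewrite divr_gt0.
have [s sP] := unit_ball_net cD eta2; exists (size s) => h hD.
have /choice[c cP] : forall i,
    exists c, c \in s /\ D c /\ dx x c (h i) <= eta / 2.
  by move=> i; have [c cs ci] := sP _ (hD i); exists c.
have /(uniqPn (h 0%N))[i [j []]] : ~~ uniq [seq c i | i <- iota 0 (size s).+1].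
  apply/negP => cU; have := uniq_leq_size cU (_ : {subset _ <= s}).
  rewrite size_map size_iota ltnn => contra.
  by suff : false by []; apply: contra => _ /mapP[i _ ->]; case: (cP i).
rewrite size_map size_iota ltnS => ij js.
have is' : (i < (size s).+1)%N by rewrite ltnS (leq_trans (ltnW ij)).
rewrite !(nth_map 0%N) ?size_iota// !nth_iota// !add0n => cij.
exists i, j; rewrite ij js; split=> //.
have [_ [[Ac _] ci]] := cP i; have [_ [_ cj]] := cP j.
have [Ai _] := hD i; have [Aj _] := hD j.
have := pdist_triangle dx_pseudo_dist Ai Ac Aj.
by rewrite (pdist_sym dx_pseudo_dist Ai Ac); rewrite -cij in cj; lra.
Qed.

(** * Homotheties of [D], when every number in (0, 1] is a modulus *)

Section Scales.
Hypothesis scales : forall s : R, 0 < s <= 1 -> exists g, nu g = s.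

(* r u w stands for delta_m w = delta_l u with nu l = s * nu m tiny, so that w
   is the image of u under a homothety of ratio s that almost fixes x. *)
Lemma homothety_relation s tau : 0 < s < 1 -> 0 < tau ->
  exists r : X -> X -> Prop,
  [/\ forall u w, r u w -> cball x A u /\ cball x A w,
      forall u w u' w', r u w -> r u' w' -> dx x w w' = s * dx x u u',
      forall u, D u -> exists w, r u w,
      forall w, cball x A w -> dx x x w <= s - tau -> exists u, r u w &
      exists2 w, r x w & dx x x w <= tau].
Proof.
move=> /andP[s0 s1] tau0.
(* [4 * eta <= 1 - s] puts delta_l u in the image of delta_m for [u] in [D]; [4 * eta <= tau] puts
   delta_m w in the image of delta_l for [w] of norm at most [s - tau], and bounds the displacement
   of [x]. *)
pose eta := Num.min tau (1 - s) / 4.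
have eta0 : 0 < eta by rewrite divr_gt0// lt_min tau0 subr_gt0.
have [eta1 eta2] : 4 * eta <= tau /\ 4 * eta <= 1 - s.
  rewrite /eta mulrC divfK//; by rewrite !ge_min !lexx orbT.
have [a a0 aP] := dil_base_small eta0.
have [b b0 bP] := dil_dist_approx eta0.
pose t := Num.min 1 (Num.min a b) / 2.
have t0 : 0 < t by rewrite divr_gt0// !lt_min ltr01 a0.
have [t1 ta tb] : [/\ t < 1, t < a & t < b].
  have : t < Num.min 1 (Num.min a b).
    by rewrite gtr_pMr ?invf_lt1 ?ltr1n// !lt_min ltr01 a0.
  by rewrite !lt_min => /andP[-> /andP[-> ->]].
have [m mt] : exists g, nu g = t by apply: scales; rewrite t0 ltW.
have st1 : s * t < 1 by nra.
have st0 : 0 < s * t by exact: mulr_gt0.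
have [l lt] : exists g, nu g = s * t by apply: scales; rewrite st0 ltW.
have stt : s * t < t by nra.
have A1 := A0_gt1 hA0.
pose r u w := [/\ cball x A u, cball x A w, delta m x w = delta l x u &
  cball x A (delta l x u)].
have xm : mdist x (delta m x x) <= eta * t.
  by rewrite -mt; apply: aP; rewrite mt.
have xl : mdist x (delta l x x) <= eta * (s * t).
  by rewrite -lt; apply: aP; rewrite lt; lra.
have dm u v : cball x A u -> cball x A v ->
    `|mdist (delta m x u) (delta m x v) - t * dx x u v| <= eta * t.
  by rewrite -mt; apply: bP; rewrite mt.
have dl u v : cball x A u -> cball x A v ->
    `|mdist (delta l x u) (delta l x v) - s * t * dx x u v| <= eta * (s * t).
  by rewrite -lt; apply: bP; rewrite lt; lra.
have rD u : D u -> exists w, r u w.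
  move=> [Au du]; have xu : mdist x (delta l x u) < t.
    have := dl _ _ cball_center Au.
    have := metric_triangle x (delta l x x) (delta l x u).
    rewrite ler_norml => ? /andP[_ ?]; nra.
  have := @dil_cover m (delta l x u); rewrite mt => /(_ t1 xu)[w Aw wE].
  by exists w; split=> //; rewrite /cball /=; lra.
exists r; split=> //.
- by move=> u w [].
- move=> u w u' w' [Au Aw wu Alu] [Au' Aw' wu' Alu'].
  have clm : closure [set g | nu g < 1] m.
    by apply: subset_closure; rewrite /= mt.
  have cll : closure [set g | nu g < 1] l.
    by apply: subset_closure; rewrite /= lt.
  have := dx_homogeneous clm Aw Aw'; rewrite wu wu' => /(_ Alu Alu').
  rewrite (dx_homogeneous cll Au Au' Alu Alu') mt lt mulrAC mulrC.
  by move=> /(mulfI (lt0r_neq0 t0)).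
- move=> w Aw xw; have xmw : mdist x (delta m x w) < s * t.
    have := dm _ _ cball_center Aw.
    have := metric_triangle x (delta m x x) (delta m x w).
    rewrite ler_norml => ? /andP[_ ?]; nra.
  have := @dil_cover l (delta m x w); rewrite lt => /(_ st1 xmw)[u Au uE].
  by exists u; split=> //; rewrite -uE /cball /=; lra.
- have [w rw] := rD _ unit_ball_center; exists w => //.
  have [_ Aw wE _] := rw; have := dm _ _ cball_center Aw.
  rewrite wE ler_norml => /andP[wt _].
  have := metric_triangle (delta m x x) x (delta l x x).
  rewrite (metric_sym (delta m x x) x) => tri.
  have e1 : eta * (s * t) <= eta * t by rewrite ler_pM2l// ltW.
  have e2 : 4 * eta * t <= tau * t by rewrite ler_pM2r.
  by rewrite -(ler_pM2l t0); have et0 := mulr_gt0 eta0 t0; lra.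
Qed.

Lemma bernoulli (t : R) n : 0 <= t <= 1 -> 1 - n%:R * t <= (1 - t) ^+ n.
Proof.
move=> /andP[t0 t1]; elim: n => [|n IHn]; first by rewrite mul0r subr0 expr0.
rewrite exprS -natr1; have : 0 <= n%:R :> R by [].
by move: (n%:R) ((1 - t) ^+ n) IHn => k q; nra.
Qed.

(** A homothety [h] of ratio near 1 need not be near the identity. If h^i u and h^j u are eta /
    2-close with i < j, then u and h^(j - i) u are eta-close, because h^i multiplies d^x by a factor
    at least 1 / 2. *)
Lemma unit_ball_radial eta : compact D -> 0 < eta ->
  exists2 kappa, 0 < kappa & forall u, D u ->
    exists u1, [/\ D u1, dx x x u1 <= 1 - kappa & dx x u u1 <= eta].
Proof.
move=> cD eta0; have eta2 : 0 < eta / 2 by rewrite divr_gt0.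
have [N NP] := unit_ball_pigeonhole cD eta2.
(* Chosen so that (1 - t)^N >= 1 - N t >= 1 / 2 by Bernoulli's inequality. *)
pose t : R := (2 * N.+1%:R)^-1.
have N0 : 0 < N.+1%:R :> R by rewrite ltr0n.
have t0 : 0 < t by rewrite invr_gt0 mulr_gt0.
have tN : N.+1%:R * t = 2^-1 by rewrite /t invfM mulrCA divff ?mulr1// gt_eqF.
have t1 : t < 1.
  have : t <= N.+1%:R * t by rewrite ler_peMl ?ler1n// ltW.
  by rewrite tN; lra.
have s01 : 0 < 1 - t < 1 by rewrite subr_gt0 t1 /= gtrBl.
have t2 : 0 < t / 2 by rewrite divr_gt0.
have [r [rA rdx rD _ [w0 rw0 xw0]]] := homothety_relation s01 t2.
(* Images of points of [D] have norm at most (1 - t) + t / 2, the second term being the displacement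
   of the centre. *)
exists (t / 2) => // u Du.
have step v : exists w, D v -> [/\ D w, r v w & dx x x w <= 1 - t / 2].
  have [Dv|] := pselect (D v); last by exists x.
  have [w rw] := rD v Dv; exists w => _.
  have [_ Aw] := rA _ _ rw; have [_ Aw0] := rA _ _ rw0.
  suff xw : dx x x w <= 1 - t / 2 by split=> //; split=> //; lra.
  have := pdist_triangle dx_pseudo_dist cball_center Aw0 Aw.
  rewrite (rdx _ _ _ _ rw0 rw); have := unit_ball_dx Dv.
  by have /andP[s0 _] := s01; nra.
have {step}[h hP] := choice step.
have Dh i v : D v -> D (iter i h v).
  by move=> Dv; elim: i => //= i /hP[].
have hdx i v w : D v -> D w ->
    dx x (iter i h v) (iter i h w) = (1 - t) ^+ i * dx x v w.
  move=> Dv Dw; elim: i => [|i IHi]; first by rewrite expr0 mul1r.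
  have [_ rv _] := hP _ (Dh i _ Dv); have [_ rw _] := hP _ (Dh i _ Dw).
  by rewrite !iterS (rdx _ _ _ _ rv rw) IHi exprS mulrA.
have [i [j [/andP[ij jN]]]] := NP (fun i => iter i h u) (fun i => Dh i u Du).
rewrite -(subnKC (ltnW ij)) iterD hdx//; last exact: Dh.
have : (0 < j - i)%N by rewrite subn_gt0.
case: (j - i)%N => // k _ uk; exists (iter k.+1 h u); split; first exact: Dh.
  by have [] := hP _ (Dh k u Du).
have : 1 / 2 <= (1 - t) ^+ i.
  apply: le_trans (_ : (1 - t) ^+ N <= _).
    apply: le_trans (bernoulli N _); last by rewrite !ltW.
    by move: tN; rewrite -natr1 mulrDl mul1r; lra.
  apply: ler_wiXn2l; [lra|lra|].
  by rewrite ltnW// (leq_trans ij).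
have := pdist_ge0 dx_pseudo_dist (unit_ball_cball Du)
  (unit_ball_cball (Dh k.+1 u Du)).
by move: uk; move: (dx x u _) ((1 - t) ^+ i) => q p; nra.
Qed.

(** A relation of distortion eta between ([D], d^x) and the [rho]-ball of radius [e] in [D] rescaled
    by 1 / e, stated on [X] so that no representatives have to be chosen. *)
Definition ball_matching (rho : X -> X -> R) (e eta : R) : Prop :=
  exists r : X -> X -> Prop,
  [/\ r x x,
      forall u, D u -> exists w, [/\ D w, rho x w <= e & r u w],
      forall w, D w -> rho x w <= e -> exists2 u, D u & r u w &
      forall u w u' w', D u -> D w -> D u' -> D w' -> r u w -> r u' w' ->
        `|e^-1 * rho w w' - dx x u u'| <= eta].

(* r relates u to its image w under a homothety of ratio s, slightly larger than
   e so that the ball of radius e is covered. *)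
Lemma ball_matching_of_homothety eta : compact D -> 0 < eta ->
  exists kappa tau, [/\ 0 < kappa <= 1, 0 < tau &
    forall (rho : X -> X -> R) (e s : R) (r : X -> X -> Prop),
      0 < e -> s = e * (1 + kappa) -> rho x x = 0 ->
      (forall u w, r u w -> cball x A u) ->
      (forall u w u' w', D w -> D w' -> r u w -> r u' w' ->
         `|rho w w' - s * dx x u u'| <= tau * s) ->
      (forall u, D u -> exists2 w, D w & r u w) ->
      (forall w, D w -> rho x w <= e -> exists u, r u w) ->
      (forall u, r u x -> dx x x u <= tau) ->
      ball_matching rho e eta].
Proof.
move=> cD eta0; have eta8 : 0 < eta / 8 by rewrite divr_gt0.
have [k1 k10 radial] := unit_ball_radial cD eta8.
(* A point of norm at most 1 - 2k is sent to [rho]-norm at most e (1 + k) (1 - 2k + k / 2) <= e; the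
   bound by [eta / 8] keeps the change of scale from [e] to [s] within the distortion. *)
pose k := Num.min 1 (Num.min k1 (eta / 8)) / 2.
have k0 : 0 < k by rewrite divr_gt0// !lt_min ltr01 k10.
have [kl1 klk kle] : [/\ 2 * k <= 1, 2 * k <= k1 & 2 * k <= eta / 8].
  by rewrite /k mulrC divfK// !ge_min !lexx !orbT.
have tau0 : 0 < k / 4 by rewrite divr_gt0.
exists k, (k / 4); split=> //; first by rewrite k0; lra.
move=> rho e s r e0 sE rho0 rA rrho rD rball rbase.
have s0 : 0 < s by rewrite sE mulr_gt0// addr_gt0.
have ek0 := mulr_gt0 e0 k0; have ekk0 := mulr_gt0 ek0 k0.
have Dx := unit_ball_center; have Ax := cball_center.
have dxP := dx_pseudo_dist.
(* The relation need not fix [x]; a preimage [u0] of [x], within k / 4 of it, plays the role of the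
   centre. *)
have [|u0 r0] := rball x Dx; first by rewrite rho0 ltW.
have Au0 := rA _ _ r0; have xu0 := rbase _ r0.
have u0u u : cball x A u -> `|dx x u0 u - dx x x u| <= k / 4.
  move=> Au; have := pdist_triangle dxP Ax Au0 Au.
  have := pdist_triangle dxP Au0 Ax Au.
  by rewrite (pdist_sym dxP Au0 Ax) ler_norml; lra.
have Du0 : D u0 by split=> //; lra.
(* Points of [D] near the unit sphere are first moved by at most eta / 8 to a smaller norm, so that
   their images stay in the ball. *)
exists (fun u w => exists u1, [/\ D u1, r u1 w & dx x u u1 <= eta / 8]).
split.
- by exists u0; split=> //; lra.
- move=> u Du; have [u1 [Du1 xu1 uu1]] := radial u Du.
  have [w Dw ruw] := rD u1 Du1; exists w; split=> //; last by exists u1.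
  have := rrho _ _ _ _ Dx Dw r0 ruw; have := u0u u1 (unit_ball_cball Du1).
  rewrite !ler_norml sE => ? /andP[_ h].
  have : e * (1 + k) * dx x u0 u1 <= e * (1 + k) * (1 - 2 * k + k / 4).
    by rewrite ler_pM2l -?sE//; lra.
  lra.
- move=> w Dw xw; have [u ruw] := rball w Dw xw; have Au := rA _ _ ruw.
  (* s d^x(x, u) <= e + s k / 2 <= s, since s - e = e k and k <= 1 / 2. *)
  suff Du : D u.
    by exists u => //; exists u; split=> //; rewrite (pdistxx dxP Au) ltW.
  split=> //; rewrite -(ler_pM2l s0) mulr1.
  have := rrho _ _ _ _ Dx Dw r0 ruw; have := u0u u Au.
  rewrite !ler_norml => /andP[h _] /andP[g _].
  have : s * dx x x u <= s * (dx x u0 u + k / 4) by rewrite ler_pM2l//; lra.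
  have ekk : e * k * k <= e * k by rewrite -[leRHS]mulr1 ler_pM2l//; lra.
  by move: (dx x x u) (dx x u0 u) h g => p q h g; rewrite sE in g *; lra.
- move=> u w u' w' Du Dw Du' Dw' [v [Dv rvw uv]] [v' [Dv' rvw' uv']].
  rewrite -(ler_pM2l e0) mulr_norm_gt0// mulrBr mulrA divff ?gt_eqF// mul1r.
  have := rrho _ _ _ _ Dw Dw' rvw rvw'; rewrite !ler_norml => /andP[h1 h2].
  have [[Au _] [Av dv] [Au' _] [Av' dv']] := And4 Du Dv Du' Dv'.
  have t1 := pdist_triangle dxP Au Av Au'.
  have t2 := pdist_triangle dxP Av Av' Au'.
  have t3 := pdist_triangle dxP Av Au Av'.
  have t4 := pdist_triangle dxP Au Au' Av'.
  have t5 := pdist_triangle dxP Av Ax Av'.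
  rewrite (pdist_sym dxP Av' Au') in t2; rewrite (pdist_sym dxP Av Au) in t3.
  rewrite (pdist_sym dxP Av Ax) in t5.
  have v0 := pdist_ge0 dxP Av Av'.
  have ekd : e * k * dx x v v' <= e * k * 2 by rewrite ler_pM2l//; lra.
  have ekd0 : 0 <= e * k * dx x v v' by rewrite mulr_ge0// ltW.
  have eke : e * (2 * k) <= e * (eta / 8) by rewrite ler_pM2l.
  have ekk : e * k * k <= e * k by rewrite -[leRHS]mulr1 ler_pM2l//; lra.
  have evu : e * dx x v v' <= e * (dx x u u' + eta / 4).
    by rewrite ler_pM2l//; lra.
  have euv : e * dx x u u' <= e * (dx x v v' + eta / 4).
    by rewrite ler_pM2l//; lra.
  have ee := mulr_gt0 e0 eta0.
  by rewrite sE in h1 h2; apply/andP; split; lra.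
Qed.

(** For the limit index the homotheties scale d^x exactly, so only the displacement of the centre
    has to be absorbed. *)
Lemma ball_matching0 eta : compact D -> 0 < eta ->
  exists2 e0, 0 < e0 & forall e, 0 < e < e0 -> ball_matching (dx x) e eta.
Proof.
move=> cD eta0.
have [k [tau [/andP[k0 k1] tau0 core]]] := ball_matching_of_homothety cD eta0.
exists 4^-1; first by rewrite invr_gt0.
move=> e /andP[e0 e4]; pose s := e * (1 + k).
have ek0 := mulr_gt0 e0 k0.
have s0 : 0 < s by rewrite mulr_gt0// addr_gt0.
have s2 : s <= 1 / 2 by rewrite /s; nra.
(* [e * k] brings norms at most [e] below [s - t], [tau * s] controls the preimages of [x], and
   [1 / 2] gives s + t <= 1, so that images stay in [D]. *)
pose t := Num.min (e * k) (Num.min (tau * s) (1 / 2)).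
have t0 : 0 < t by rewrite !lt_min ek0 mulr_gt0 //= divr_gt0.
have [te tt t2] : [/\ t <= e * k, t <= tau * s & t <= 1 / 2].
  by rewrite /t !ge_min !lexx !orbT.
have s01 : 0 < s < 1 by rewrite s0; lra.
have [r [rA rdx rD rball [w0 rw0 xw0]]] := homothety_relation s01 t0.
have [_ Aw0] := rA _ _ rw0; have Ax := cball_center; have dxP := dx_pseudo_dist.
apply: (core _ _ s r) => //.
- exact: pdistxx dxP _ _.
- by move=> u w /rA[].
- move=> u w u' w' _ _ ruw ruw'.
  by rewrite (rdx _ _ _ _ ruw ruw') subrr normr0 mulr_ge0// ltW.
- move=> u Du; have [w ruw] := rD u Du; exists w => //.
  have [_ Aw] := rA _ _ ruw; split=> //.
  have := pdist_triangle dxP Ax Aw0 Aw; rewrite (rdx _ _ _ _ rw0 ruw).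
  have : s * dx x x u <= s by rewrite ger_pMr// unit_ball_dx.
  lra.
- by move=> w [Aw _] xw; apply: rball => //; rewrite /s; lra.
- move=> u rux; have := rdx _ _ _ _ rw0 rux.
  rewrite (pdist_sym dxP Aw0 Ax) => xE.
  by rewrite -(ler_pM2l s0) -xE; lra.
Qed.

(** * Small balls of the rescaled distance at a fixed coefficient [g] *)

Section Rescaled.
Variable g : G.
(** A2 handles outer coefficients of modulus < 1; the coefficient 1, which acts as the identity, is
    the index 1 of the profile. *)
Hypothesis g1 : nu g < 1 \/ g = 1%g.

Let g_le1 : nu g <= 1.
Proof. by case: g1 => [/ltW//|->]; rewrite modulus1. Qed.

Let rho := dil_dist nu delta g x.

(** By A2, delta_g delta_m is comparable with delta_{gm}, to which A3 applies; dividing by [nu g]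
    leaves errors proportional to [nu m]. *)
Lemma dil_dist_comp_approx tau : 0 < tau ->
  exists2 a, 0 < a & forall m, nu m < a -> forall u v,
    cball x A u -> cball x A v ->
    `|rho (delta m x u) (delta m x v) - nu m * dx x u v| <= tau * nu m.
Proof.
move=> tau0; have tau2 : 0 < tau / 2 by rewrite divr_gt0.
have [a a0 aP] := dil_dist_approx tau2; have [b b0 bP] := dil_comp_approx tau2.
exists (Num.min 1 (Num.min a b)); first by rewrite !lt_min ltr01 a0.
move=> m; rewrite !lt_min => /andP[m1 /andP[ma mb]] u v Au Av.
have m0 := nu_gt0 m; have g0 := nu_gt0 g.
rewrite -(ler_pM2l g0) mulr_norm_gt0// mulrBr /rho /dil_dist mulrA.
rewrite divff ?gt_eqF// mul1r.
case: g1 => [gl1|gE].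
  have gm : nu g * nu m < nu m by rewrite gtr_pMl.
  have := bP g m u v gl1 m1 (lt_trans gm mb) Au Av.
  have := aP (g * m)%g; rewrite nuM => /(_ (lt_trans gm ma) u v Au Av).
  by rewrite !ler_norml; lra.
have Uu w : cball x A w -> U x (delta m x w).
  by move=> Aw; apply: dil_in_dom => //; exact: cball_dom.
rewrite gE !(A1_id hA1) ?modulus1 ?mul1r; [|exact: Uu|exact: Uu].
have := aP m ma u v Au Av; have := mulr_gt0 tau0 m0; rewrite !ler_norml; lra.
Qed.

(** The inverse of delta_g provided by A0 is continuous at delta_g x. *)
Lemma dil_dist_separates r : 0 < r ->
  exists2 a, 0 < a & forall w, U x w -> rho x w <= a -> mdist x w < r.
Proof.
move=> r0; have [VE _ [h [hC hK]]] := A0_homeo hA0 x g_le1.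
have Ux := cball_dom cball_center; have g0 := nu_gt0 g.
have Vx : V g x (delta g x x) by rewrite -VE; exists x.
move: hC => /subspace_continuousP/(_ _ Vx).
move=> /(@metricType_numDomainType.cvgrPdist_lt _ X)/(_ _ r0).
rewrite near_withinE => /metricType_numDomainType.nbhs_mdistP[b /= b0 bP].
exists (b / (2 * nu g)); first by rewrite divr_gt0// mulr_gt0.
move=> w Uw; rewrite /rho /dil_dist ler_pdivrMl// => xw.
have Vw : V g x (delta g x w) by rewrite -VE; exists w.
suff dw : mdist (delta g x x) (delta g x w) < b.
  by have := bP _ dw Vw; rewrite /from_subspace (hK x Ux) (hK w Uw).
have bE : nu g * (b / (2 * nu g)) = b / 2.
  by rewrite invfM mulrCA [nu g * _]mulrCA divff ?gt_eqF// mulr1.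
by rewrite bE in xw; lra.
Qed.

(* rho x w and mdist x w agree to first order as w tends to x, so the rho-ball
   of radius e lies in the mdist-ball of radius nu m, which delta m x covers. *)
Lemma dil_ball_cover k : 0 < k <= 1 ->
  exists2 e0, 0 < e0 & forall e m w, 0 < e < e0 -> nu m = e * (1 + k) ->
    D w -> rho x w <= e -> exists2 u, cball x A u & w = delta m x u.
Proof.
move=> /andP[k0 k1]; have k16 : 0 < k / 16 by rewrite divr_gt0.
have [a a0 aP] := dil_dist_approx k16.
have [b b0 bP] := dil_dist_comp_approx k16.
pose r := Num.min 1 (Num.min a b) / 4.
have r0 : 0 < r by rewrite divr_gt0// !lt_min ltr01 a0.
have [r1 ra rb] : [/\ 4 * r <= 1, 4 * r <= a & 4 * r <= b].
  by rewrite /r mulrC divfK// !ge_min !lexx !orbT.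
have [c c0 cP] := dil_dist_separates r0.
exists (Num.min c r); first by rewrite lt_min c0.
move=> e m w /andP[e0]; rewrite lt_min => /andP[ec er] mE [Aw _] xw.
have ek0 := mulr_gt0 e0 k0.
have ek1 : e * k <= e by rewrite ger_pMr.
have m1 : nu m < 1 by rewrite mE; lra.
apply: dil_cover => //; rewrite mE ltNge; apply/negP => xwe.
have xwr : mdist x w < r by apply: cP; [exact: cball_dom|lra].
have xw0 : 0 < mdist x w by lra.
(* At this modulus the image of delta_n contains both [x] and [w]. Comparing [rho] and d with d^x
   there gives rho x w >= (1 - k / 4) d(x, w) >= (1 - k / 4) (1 + k) e > e. *)
have [n nE] : exists n, nu n = 2 * mdist x w by apply: scales; lra.
have n1 : nu n < 1 by rewrite nE; lra.
have [u Au uE] : exists2 u, cball x A u & w = delta n x u.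
  by apply: dil_cover => //; rewrite nE; lra.
have [u0 Au0 u0E] : exists2 u, cball x A u & x = delta n x u.
  by apply: dil_cover => //; rewrite nE mdistxx; lra.
have := aP n (_ : nu n < a) u0 u Au0 Au.
have := bP n (_ : nu n < b) u0 u Au0 Au.
rewrite -uE -u0E nE => /(_ ltac:(lra)) + /(_ ltac:(lra)).
have kt : k / 4 * (e * (1 + k)) <= k / 4 * mdist x w by rewrite ler_pM2l//; lra.
have ekk : e * k * k <= e * k by rewrite -[leRHS]mulr1 ler_pM2l.
have kt1 : (1 - k / 4) * (e * (1 + k)) <= (1 - k / 4) * mdist x w.
  by rewrite ler_pM2l//; lra.
rewrite !ler_norml => /andP[h _] /andP[_ h'].
move: (dx x u0 u) h h' => q h h'; lra.
Qed.

(** Here delta_m itself, with [nu m = e * (1 + k)], is the approximate homothety. *)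
Lemma ball_matching_dil_dist eta : compact D -> 0 < eta ->
  exists2 e0, 0 < e0 & forall e, 0 < e < e0 -> ball_matching rho e eta.
Proof.
move=> cD eta0.
have [k [tau [/andP[k0 k1] tau0 core]]] := ball_matching_of_homothety cD eta0.
have tau2 : 0 < tau / 2 by rewrite divr_gt0.
have [a a0 aP] := dil_dist_comp_approx tau0.
have [a' a'0 aP'] := dil_dist_approx tau2.
have [b b0 bP] := dil_base_small tau2.
have [q q0 qD] := unit_ball_near.
have [c c0 cP] := dil_unit_ball_near q0.
have k01 : 0 < k <= 1 by rewrite k0.
have [e1 e10 e1P] := dil_ball_cover k01.
pose z := Num.min (Num.min 1 a) (Num.min (Num.min a' b) c).
have z0 : 0 < z by rewrite !lt_min ltr01 a0 a'0 b0 c0.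
exists (Num.min e1 (z / 2)); first by rewrite lt_min e10 divr_gt0.
move=> e /andP[e0]; rewrite lt_min => /andP[ee1 ez].
pose s := e * (1 + k).
have s0 : 0 < s by rewrite mulr_gt0// addr_gt0.
have : s < z by rewrite /s; nra.
rewrite !lt_min => /andP[/andP[s1 sa] /andP[/andP[sa' sb] sc]].
have [m mE] : exists m, nu m = s by apply: scales; rewrite s0 ltW.
apply: (core _ _ s (fun u w => cball x A u /\ w = delta m x u)) => //.
- by rewrite /rho /dil_dist mdistxx mulr0.
- by move=> u w [].
- move=> u w u' w' _ _ [Au ->] [Au' ->]; rewrite -mE.
  by apply: aP => //; rewrite mE.
- move=> u Du; exists (delta m x u); last by case: Du.
  by apply: qD; apply: cP => //; rewrite mE.
- move=> w Dw xw; have [|u Au wE] := e1P e m w _ mE Dw xw; first by rewrite e0.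
  by exists u.
- move=> u [Au xE]; have := bP m; rewrite mE => /(_ sb).
  have := aP' m; rewrite mE => /(_ sa' _ _ cball_center Au).
  rewrite -xE (metric_sym _ x) ler_norml => /andP[h _] h'.
  by rewrite -(ler_pM2l s0); lra.
Qed.

End Rescaled.

(** * Representatives of the classes, and the metric profile *)

Lemma dx_represented : compact D ->
  exists (Y : pcms R) (f : X -> Y), represents D (dx x) x f.
Proof.
move=> cD; apply: pcms_of_pseudo_dist => //; last 1 first.
- move=> l [Al _]; rewrite -(pdistxx dx_pseudo_dist Al).
  apply: (@dx_cvg _ (within D (nbhs l)) id) => //.
  + exact: (@cvg_within _ (nbhs l) (nbhs_filter l) D).
  + by apply: filterS (withinT D _) => u [].
- split=> [u|u v|u v w]; [move=> /unit_ball_cball Au|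
      move=> /unit_ball_cball Au /unit_ball_cball Av|
      move=> /unit_ball_cball Au /unit_ball_cball Av /unit_ball_cball Aw].
  + exact: pdistxx dx_pseudo_dist _ Au.
  + exact: pdist_sym dx_pseudo_dist _ _ Au Av.
  + exact: pdist_triangle dx_pseudo_dist _ _ _ Au Av Aw.
- exact: unit_ball_center.
Qed.

Lemma dil_dist_represented g : compact D -> nu g <= 1 ->
  exists (Y : pcms R) (f : X -> Y), represents D (dil_dist nu delta g x) x f.
Proof.
move=> cD g1; have gV0 : 0 < (nu g)^-1 by rewrite invr_gt0.
apply: pcms_of_pseudo_dist => //; last 1 first.
- move=> l [Al _].
  suff : dil_dist nu delta g x l u @[u --> within D (nbhs l)] -->
      (nu g)^-1 * mdist (delta g x l) (delta g x l) by rewrite mdistxx mulr0.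
  apply: cvgM; first exact: cvg_cst.
  apply: mdist_cvg; first exact: cvg_cst.
  apply: (@within_comp_cvg _ _ _ (within D (nbhs l)) (U x) (delta g x) id).
  + exact: dil_continuous.
  + exact: cball_dom.
  + exact: (@cvg_within _ (nbhs l) (nbhs_filter l) D).
  + by apply: filterS (withinT D _) => u [/cball_dom].
- split=> [u _|u v _ _|u v w _ _ _]; rewrite /dil_dist.
  + by rewrite mdistxx mulr0.
  + by rewrite metric_sym.
  + by rewrite -mulrDr ler_pM2l// metric_triangle.
- exact: unit_ball_center.
Qed.

Lemma dil_dist_eq0 g u v : nu g <= 1 -> D u -> D v ->
  dil_dist nu delta g x u v = 0 -> u = v.
Proof.
move=> g1 [/cball_dom Uu _] [/cball_dom Uv _] /eqP.
rewrite mulf_eq0 gt_eqF ?invr_gt0//= => /eqP/mdist_positivity uv.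
by have [_ _ [h [_ hK]]] := A0_homeo hA0 x g1; rewrite -(hK u Uu) uv hK.
Qed.

End Scales.

Lemma unit_ball_profile (gam : R -> G) : compact D -> gam 1 = 1%g ->
  (forall e, 0 < e <= 1 -> nu (gam e) = e) ->
  exists P : R -> CMS R,
    (forall e, 0 < e <= 1 ->
       is_class D (dil_dist nu delta (gam e) x) x (P e)) /\
    metric_profile 1 P.
Proof.
move=> cD gam1 gamE.
have scales s : 0 < s <= 1 -> exists g, nu g = s.
  by move=> s01; exists (gam s); exact: gamE.
(* The value d^x at index 0 is the extension by continuity. *)
pose sigma e := if e == 0 then dx x else dil_dist nu delta (gam e) x.
have sigmaE e : 0 < e -> sigma e = dil_dist nu delta (gam e) x.
  by move=> e0; rewrite /sigma gt_eqF.
have /choice[yf yfP] : forall e, exists yf : {Y : pcms R & X -> Y},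
    0 <= e <= 1 -> represents D (sigma e) x (projT2 yf).
  move=> e; have [e01|ne] := boolP (0 <= e <= 1); last first.
    by have [Y [f _]] := dx_represented cD; exists (existT _ Y f).
  have [e0|ne0] := eqVneq e 0.
    have [Y [f fP]] := dx_represented cD; exists (existT _ Y f) => _ /=.
    by rewrite /sigma e0 eqxx.
  have e0 : 0 < e <= 1 by rewrite lt_def ne0.
  have [|Y [f fP]] := @dil_dist_represented (gam e) cD.
    by rewrite gamE//; case/andP: e0.
  by exists (existT _ Y f) => _ /=; rewrite /sigma (negbTE ne0).
pose P e := iso_class (projT1 (yf e)).
have sigma_near eta : 0 < eta -> exists2 a, 0 < a & forall e, 0 <= e <= 1 ->
    e < a -> forall u v, D u -> D v -> `|sigma e u v - dx x u v| <= eta.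
  move=> eta0; have [a a0 aP] := dil_dist_approx eta0.
  exists a => // e e01 ea u v [Au _] [Av _]; rewrite /sigma.
  have [_|ne0] := eqVneq e 0; first by rewrite subrr normr0 ltW.
  have e0 : 0 < e by rewrite lt_def ne0; case/andP: e01.
  have eE : nu (gam e) = e by apply: gamE; rewrite e0; case/andP: e01.
  have := aP (gam e); rewrite eE => /(_ ea u v Au Av).
  rewrite -(ler_pM2l e0 _ eta) mulr_norm_gt0// mulrBr /dil_dist eE mulrA.
  by rewrite divff// mul1r (mulrC e eta).
have sigma_matching b eta : 0 <= b <= 1 -> 0 < eta ->
    exists2 e0, 0 < e0 & forall e, 0 < e < e0 -> ball_matching (sigma b) e eta.
  move=> /andP[b0 b1] eta0; rewrite /sigma.
  have [_|nb0] := eqVneq b 0; first exact: ball_matching0.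
  have bE : nu (gam b) = b by apply: gamE; rewrite lt_def nb0 b0.
  apply: ball_matching_dil_dist => //.
  by move: b1; rewrite le_eqVlt => /orP[/eqP->|b1]; [right|left; rewrite bE].
exists P; split.
  move=> e /andP[e0 e1]; have e01 : 0 <= e <= 1 by rewrite ltW.
  rewrite -sigmaE//; apply: represents_class (yfP e e01) _ _.
    exact: unit_ball_center.
  by rewrite sigmaE//; move=> u v; apply: dil_dist_eq0; rewrite gamE ?e0.
have z01 : 0 <= (0 : R) <= 1 by rewrite lexx ler01.
split.
  apply/cvgrPdist_le => eta eta0; have [a a0 aP] := sigma_near eta eta0.
  near=> b.
  have b01 : 0 <= b <= 1 by apply/andP; split; near: b;
    [exact: nbhs_right_ge|exact: nbhs_right_le].
  have ba : b < a by near: b; exact: nbhs_right_lt.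
  rewrite sub0r normrN ger0_norm ?CMS_dist_ge0//; apply: CMS_dist_le.
  (* The identity relation on [D] has distortion at most eta by A3. *)
  apply: (GH_admissible_relation (yfP b b01) (yfP 0 z01) eta0
    unit_ball_center unit_ball_center (r := eq)) => //.
  - by move=> u Du; exists u.
  - by move=> u Du; exists u.
  - move=> u _ u' _ Du _ Du' _ <- <-; rewrite distrC /sigma eqxx.
    exact: aP.
move=> b b01.
pose Y := projT1 (yf b); pose f : X -> Y := projT2 (yf b).
have fP : represents D (sigma b) x f := yfP b b01.
have [fd fS fx] := fP.
(* One representative of each rescaled ball is fixed, so that the error is a function of [e]
   alone. *)
have /choice[zh zhP] : forall e : R, exists zh : {Z : pcms R & Y -> Z}, 0 < e ->
    represents [set y : Y | e^-1 * mdist (pcms_pt Y) y <= 1]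
      (fun u v => e^-1 * mdist u v) (pcms_pt Y) (projT2 zh).
  move=> e; have [e0|_] := ltP 0 e; last by exists (existT _ Y id).
  by have [Z [h hP]] := rescaled_ball_class Y e0; exists (existT _ Z h).
pose err e := CMS_dist (P (e * b)) (iso_class (projT1 (zh e))).
(* The added [e], and the value 1 for e <= 0, make the error function strictly positive. *)
exists (fun e => if 0 < e then e + err e else 1); split.
- by move=> e; case: ifP => // e0; rewrite ltr_pwDl// CMS_dist_ge0.
- apply/cvgrPdist_le => eta eta0.
  have eta2 : 0 < eta / 2 by rewrite divr_gt0.
  have eta4 : 0 < eta / 4 by rewrite divr_gt0.
  have [a a0 aP] := sigma_near _ eta4.
  have [e1 e10 e1P] := sigma_matching b _ b01 eta4.
  near=> e.
  have e0 : 0 < e by near: e; exact: nbhs_right_gt.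
  have ee1 : e < e1 by near: e; exact: nbhs_right_lt.
  have ea : e < a by near: e; exact: nbhs_right_lt.
  have eeta : e <= eta / 2 by near: e; exact: nbhs_right_le.
  have e1' : e <= 1 by near: e; exact: nbhs_right_le.
  rewrite e0 sub0r normrN ger0_norm; last first.
    by rewrite addr_ge0 ?CMS_dist_ge0// ltW.
  suff : err e <= eta / 2 by lra.
  have /andP[b0 b1] := b01.
  have eb : e * b <= e by rewrite ger_pMr.
  have eb0 : 0 <= e * b by rewrite mulr_ge0// ltW.
  have eb01 : 0 <= e * b <= 1 by rewrite eb0 (le_trans eb).
  have [|r [rx rdom rim rdist]] := e1P e; first by rewrite e0.
  have ballE w : D w ->
      (e^-1 * mdist (pcms_pt Y) (f w) <= 1) = (sigma b x w <= e).
    by move=> Dw; rewrite -fx fd ?ler_pdivrMl ?mulr1//; exact: unit_ball_center.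
  (* Two distortions of eta / 4 add up: from index e b to d^x by A3, and from d^x to the rescaled
     ball of index b by the matching [r]. *)
  apply: CMS_dist_le; apply: (GH_admissible_relation (yfP _ eb01) (zhP e e0)
    eta2 unit_ball_center _
    (r := fun u y => exists w, [/\ D w, y = f w & r u w])).
  + by rewrite /= mdistxx mulr0.
  + by exists x; rewrite fx; split=> //; exact: unit_ball_center.
  + move=> u Du; have [w [Dw xw ruw]] := rdom u Du.
    by exists (f w); [rewrite /= ballE|exists w].
  + move=> y; have [w Dw <-] : (f @` D) y by rewrite fS.
    rewrite /= ballE// => xw; have [u Du ruw] := rim w Dw xw.
    by exists u => //; exists w.
  + move=> u y u' y' Du _ Du' _ [w [Dw -> ruw]] [w' [Dw' -> ruw']].
    rewrite fd//; have := rdist _ _ _ _ Du Dw Du' Dw' ruw ruw'.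
    have := aP _ eb01 (le_lt_trans eb ea) _ _ Du Du'.
    by rewrite !ler_norml; lra.
- move=> e Y' /andP[e0 e1] PbE; exists (iso_class (projT1 (zh e))).
    apply: rescaled_ball_is_class (zhP e e0) _ => //.
    by apply/isometric_sym/iso_classP.
  by rewrite e0 lerDr ltW.
Unshelve. all: by end_near. Qed.

End TangentSpace.

Theorem theorem6 (R : realType) (G : commTopGroupType) (nu : G -> R)
    (X : metricType R) (A B : R) (U : X -> set X) (V W : G -> X -> set X)
    (delta : G -> X -> X -> X) (dx : X -> X -> X -> R)
    (G_hausdorff : hausdorff_space G) (nu_modulus : is_modulus nu)
    (X_complete : @complete_space R X)
    (X_locally_compact : locally_compact [set: X])
    (hA0 : dilatation_A0 nu A B U V W delta)
    (hA1 : dilatation_A1 nu U W delta)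
    (hA2 : dilatation_A2 nu A delta)
    (hA3 : dilatation_A3 nu A delta dx)
    (x : X) :
  (forall (u v : X) (mu : G),
     mdist x u <= 1 -> mdist x v <= 1 ->
     0 < nu mu < A -> A2_determined nu mu ->
     dil_dom nu U W (mu, x, u) -> dil_dom nu U W (mu, x, v) ->
     cball x A (delta mu x u) -> cball x A (delta mu x v) ->
     dx x u v = (nu mu)^-1 * dx x (delta mu x u) (delta mu x v))
  /\
  (forall gam : R -> G,
     gam 1 = 1%g -> (forall e : R, 0 < e <= 1 -> nu (gam e) = e) ->
     exists P : R -> CMS R,
       (forall e : R, 0 < e <= 1 ->
          is_class (dx_unit_ball A dx x) (dil_dist nu delta (gam e) x) x (P e))
       /\ metric_profile 1 P).
Proof.
split=> [u v mu u1 v1 _ mdet|gam gam1 gamE].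
  exact: (dx_scaling nu_modulus hA0 hA1 hA2 hA3 u1 v1 mdet).
apply: (unit_ball_profile nu_modulus hA0 hA1 hA2 hA3) => //.
exact: (unit_ball_compact nu_modulus hA0 hA1 hA3).
Qed.
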